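(* Let $u=u(x;a,E,c)$ be a $T$-periodic traveling wave profile with $T_a,T_E$ not both zero, and let $\mathbf{M}(\mu)$ be the monodromy matrix of $\partial_x\mathcal{L}[u]v=\mu v$ and $D(\mu,\lambda)=\det(\mathbf{M}(\mu)-\lambda\mathbf{I})$. In a neighborhood of $(\mu,\kappa)=(0,0)$ the equation $D(\mu,e^{i\kappa})=0$ has the normal form $$-(i\kappa)^3+\frac{i\kappa\mu^2}{2}\operatorname{tr}(\mathbf{M}_{\mu\mu}(0))+\frac{\mu^3}{3}\operatorname{tr}(\mathbf{M}_{\mu\mu\mu}(0))+O(4)=0,$$ where $O(4)$ denotes terms of total degree four or higher in $(\mu,\kappa)$; that is, the left-hand side is the Taylor expansion of $D(\mu,e^{i\kappa})$ at $(0,0)$ through total degree three.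
   Context: Let $f\in C^2(\mathbb{R})$, $F'=f$, and for real parameters $(a,E,c)$ set $V(u;a,c)=F(u)-\frac{c}{2}u^2-au$. Standing assumption: $(a,E,c)$ lies in the interior of the parameter region for which $V(\cdot;a,c)$ has a local minimum and there are simple roots $u_-<u_+$ of $V(u;a,c)=E$ with $V(u;a,c)<E$ on $(u_-,u_+)$. Then $u(x)=u(x;a,E,c)$ denotes the nonconstant periodic solution of $\frac12u_x^2+V(u;a,c)=E$ (so $u_{xx}+f(u)-cu=a$) with $u(0)=u_-$, $u_x(0)=0$, and $T=T(a,E,c)=2\int_{u_-}^{u_+}\frac{du}{\sqrt{2(E-V(u;a,c))}}$ is its period, with partial derivatives $T_a,T_E$. Set $\mathcal{L}[u]=-\partial_x^2-f'(u)+c$. For $\mu\in\mathbb{C}$ let $\mathbf{M}(\mu)=\Phi(T,\mu)$, where $\Phi_x=\mathbf{H}(x;\mu)\Phi$, $\Phi(0,\mu)=\mathbf{I}$ and $\mathbf{H}(x;\mu)=\begin{pmatrix}0&1&0\\0&0&1\\-\mu-u_xf''(u)&-f'(u)+c&0\end{pmatrix}$; this is the first order system for $\partial_x\mathcal{L}[u]v=\mu v$. Subscripts $\mu$ denote derivatives in $\mu$. *)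

(* Defs.v *)
(* MathComp-Analysis, over an arbitrary [R : realType]. *)
From mathcomp Require Import all_boot all_order all_algebra.
From mathcomp Require Import all_classical all_reals all_analysis.
From mathcomp Require Import complex.

Set Implicit Arguments.
Unset Strict Implicit.
Unset Printing Implicit Defensive.
Import Order.TTheory GRing.Theory Num.Theory numFieldNormedType.Exports.
Local Open Scope ring_scope.
Local Open Scope classical_set_scope.

(* [R[i]] seen as a [numFieldType]: in this form it inherits its topology and
   its structure of normed module over itself, so that [derive1] of a function
   on [Cplx R] is the complex derivative. *)
Definition Cplx (R : realType) : numFieldType := R[i].

Section Complex.
Context {R : realType}.

Definition ofR (x : R) : Cplx R := (x%:C)%C.

Definition iC : Cplx R := 'i%C.

Definition expC (z : Cplx R) : Cplx R :=
  ofR (expR (complex.Re z)) *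
  (ofR (cos (complex.Im z)) + iC * ofR (sin (complex.Im z))).

(* [Cplx R] is not a normed module over [R] in the library, so the derivative
   of a complex-valued function of a real variable is taken on the real and
   imaginary parts. *)
Definition is_derive_RC (x : R) (g : R -> Cplx R) (dg : Cplx R) : Prop :=
  is_derive x 1 (fun y => complex.Re (g y)) (complex.Re dg) /\
  is_derive x 1 (fun y => complex.Im (g y)) (complex.Im dg).

End Complex.

Section TravelingWave.
Context {R : realType}.

Definition C2 (f : R -> R) : Prop :=
  [/\ forall x, derivable f x 1,
      forall x, derivable (derive1 f) x 1
    & continuous (derive1n 2 f)].

(* Parameter triples [(a, E, c)]. *)
Definition params : Type := (R * R * R)%type.
Definition pa (p : params) : R := p.1.1.
Definition pE (p : params) : R := p.1.2.
Definition pc (p : params) : R := p.2.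

Definition potential (F : R -> R) (p : params) (v : R) : R :=
  F v - pc p / 2 * v ^+ 2 - pa p * v.

Definition has_local_min (V : R -> R) : Prop :=
  exists v0, \forall v \near v0, V v0 <= V v.

Definition simple_root (V : R -> R) (E v : R) : Prop :=
  V v = E /\ derive1 V v <> 0.

Definition admissible (F : R -> R) (p : params) (um up : R) : Prop :=
  [/\ has_local_min (potential F p),
      um < up,
      simple_root (potential F p) (pE p) um,
      simple_root (potential F p) (pE p) up
    & forall v, um < v < up -> potential F p v < pE p].

(* [p] is interior to the region of admissible parameters. As [V] may have
   several wells at the same energy, [u_-] and [u_+] are functions of the
   parameters only once a continuous branch of roots is fixed near [p]. *)
Definition root_branch (F : R -> R) (p : params) (um up : params -> R) : Prop :=
  \forall q \near (p : R * R * R),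
    [/\ admissible F q (um q) (up q),
        {for q, continuous (um : R * R * R -> R)}
      & {for q, continuous (up : R * R * R -> R)}].

Definition period (F : R -> R) (um up : params -> R) (p : params) : R :=
  2 * \int[lebesgue_measure]_(v in `]um p, up p[)
        (Num.sqrt (2 * (pE p - potential F p v)))^-1.

Record is_profile (f F : R -> R) (p : params) (um T : R) (u : R -> R) : Prop := {
  profile_derivable : forall x, derivable u x 1;
  profile_derivable2 : forall x, derivable (derive1 u) x 1;
  profile_ode : forall x, derive1n 2 u x + f (u x) - pc p * u x = pa p;
  profile_energy : forall x,
    derive1 u x ^+ 2 / 2 + potential F p (u x) = pE p;
  profile_init : u 0 = um;
  profile_init' : derive1 u 0 = 0;
  profile_nonconstant : exists x, u x <> u 0;
  profile_periodic : forall x, u (x + T) = u x }.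

Definition Hmx (f : R -> R) (c : R) (u : R -> R) (x : R) (mu : Cplx R) :
    'M[Cplx R]_3 :=
  \matrix_(i < 3, j < 3) nth 0 (nth [::]
    [:: [:: 0; 1; 0];
        [:: 0; 0; 1];
        [:: - mu - ofR (derive1 u x * derive1n 2 f (u x));
            ofR (- derive1 f (u x) + c);
            0]] i) j.

Definition fundamental_solution (f : R -> R) (c : R) (u : R -> R)
    (Phi : R -> Cplx R -> 'M[Cplx R]_3) : Prop :=
  forall mu, Phi 0 mu = 1%:M /\
    forall x i j,
      is_derive_RC x (fun y => Phi y mu i j) ((Hmx f c u x mu *m Phi x mu) i j).

End TravelingWave.

(* Main.v *)
(* Let [Psi] be the adjugate of [Phi].  As [H] is traceless, [Psi] is the
   inverse of [Phi], so that [D(mu, l) = - l^3 + tr M l^2 - tr M^-1 l + 1].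
   If [w] solves the adjoint system at [mu], then [w'] solves the system at
   [- mu]; by periodicity this conjugates [M(mu)^-T] with [M(- mu)], whence
   [tr M(mu)^-1 = tr M(- mu)].  The normal form is therefore the Taylor
   expansion of [tr M] at 0, once [tr M(0) = 3] and [tr M_mu(0) = 0].

   At [mu = 0], [u_x] spans a line of periodic solutions, and the multipliers
   [1] and [u] of [d_x L] give two periodic adjoint solutions.  This forces
   [M(0) - I] to be [e2] times a row vector, so [tr M(0) = 3], and
   [- tr M_mu(0)] is the integral over a period of a combination of [u_x] and
   [u u_x], hence vanishes.

   Smoothness in [mu] comes from the identity
   [Phi(nu) - Phi(mu) = (nu - mu) Phi(mu) int Psi(mu) J Phi(nu)], where
   [J] is the derivative of [H] in [mu]: the algebra generated by the entries
   of [Phi] and closed under primitives in [x] is stable under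
   differentiation in [mu]. *)
Require Import Defs.
From mathcomp Require Import all_boot all_order all_algebra.
From mathcomp Require Import all_classical all_reals all_analysis.
From mathcomp Require Import complex ring lra.
Set Implicit Arguments.
Unset Strict Implicit.
Unset Printing Implicit Defensive.
Import Order.TTheory GRing.Theory Num.Theory numFieldNormedType.Exports.
Local Open Scope ring_scope.
Local Open Scope classical_set_scope.

(** * Primitives of continuous functions on the whole real line *)

Section RealVariable.
Context {R : realType}.
Implicit Types (g h dg dh : R -> R) (x y : R).

Lemma is_derive_continuous g dg :
  (forall x, is_derive x 1 g (dg x)) -> continuous g.
Proof.
move=> gdg x; apply/differentiable_continuous/derivable1_diffP.
exact: ex_derive.
Qed.

Lemma eq_is_derive {K : numFieldType} {V W : normedModType K}
    (x v : V) (g : V -> W) (d e : W) :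
  d = e -> is_derive x v g d -> is_derive x v g e.
Proof. by move=> ->. Qed.

Let mu := @lebesgue_measure R.

(** The integral from [b] is zero to the left of [b], so it is in general a primitive only beyond
    [b]. The fundamental theorem is applied on the segment ending at [x + 1], which has [x] in its
    interior. *)
Lemma antiderivative_right {g} (b : R) : continuous g ->
  exists G, forall x, b < x -> is_derive x 1 G (g x).
Proof.
move=> cg; exists (fun x => \int[mu]_(t in `[b, x]) g t) => x bx.
have x1 : x < x + 1 by rewrite ltrDl.
have ig : mu.-integrable `[b, x + 1] (EFin \o g).
  apply: continuous_compact_integrable; first exact: segment_compact.
  exact: continuous_subspaceT.
have [dG Ge] := @continuous_FTC1_closed R g b x (x + 1) x1 ig bx (cg x).
by apply: DeriveDef => //; rewrite -derive1E.
Qed.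

Lemma is_derive_eq_right (b : R) g h dg :
  (forall x, b < x -> is_derive x 1 g (dg x)) ->
  (forall x, b < x -> is_derive x 1 h (dg x)) ->
  forall x y, b < x -> b < y -> g x - g y = h x - h y.
Proof.
move=> Hg Hh; suff wlg x y : b < x -> x <= y -> g x - g y = h x - h y.
  move=> x y bx b_y; have [xy|/ltW yx] := leP x y; first exact: wlg.
  by have := wlg y x b_y yx; lra.
move=> bx xy.
have D z : x <= z -> is_derive z 1 (g - h) 0.
  move=> xz; have bz := lt_le_trans bx xz.
  have Dg := Hg z bz; have Dh := Hh z bz.
  by apply: eq_is_derive (is_deriveB Dg Dh); rewrite subrr.
have [] := @MVT_segment R (g - h) (fun=> 0) x y xy.
- by move=> z; rewrite in_itv/= => /andP[xz _]; apply: D; exact: ltW.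
- apply: derivable_within_continuous => z; rewrite in_itv/= => /andP[xz _].
  by have := D z xz => -[].
- by move=> c _; rewrite mul0r /= !fctE /=; lra.
Qed.

(** Primitives on the half-lines beyond [- n.+1], normalized to vanish at 0, agree on overlaps by
    uniqueness and therefore glue. *)
Lemma antiderivative {g} : continuous g ->
  exists2 G, G 0 = 0 & forall x, is_derive x 1 G (g x).
Proof.
move=> cg.
have /choice[G HG] : forall n : nat, exists G, G 0 = 0 /\
    forall x, - (n.+1%:R) < x -> is_derive x 1 G (g x).
  move=> n; have [G HG] := antiderivative_right (- n.+1%:R) cg.
  exists (G - cst (G 0)); split; first by rewrite !fctE subrr.
  move=> x /HG Dx.
  by apply: eq_is_derive (is_deriveB Dx (is_derive_cst _ _ _)); rewrite subr0.
pose n x := Num.trunc `|x|.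
have nP x : - (n x).+1%:R < x.
  by rewrite ltrNl; apply: le_lt_trans (ler_norm _) _; rewrite normrN truncnS_gt.
have agree m k x : - m.+1%:R < x -> - k.+1%:R < x -> G m x = G k x.
  move=> mx kx; wlog mk : m k mx kx / (m <= k)%N.
    by move=> W; have [/W->|/ltnW/W->] := leqP m k.
  have [Gm0 HGm] := HG m; have [Gk0 HGk] := HG k.
  have HGk' y : - m.+1%:R < y -> is_derive y 1 (G k) (g y).
    move=> my; apply: HGk; apply: le_lt_trans my.
    by rewrite lerN2 ler_nat ltnS.
  have m0 : - m.+1%:R < (0:R) by rewrite oppr_lt0 ltr0Sn.
  by have := is_derive_eq_right HGm HGk' mx m0; rewrite Gm0 Gk0 !subr0.
exists (fun x => G (n x) x); first by have [] := HG (n 0).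
move=> x.
(* The index [n y] may jump with [y], but near [x] the glued function coincides with the single
   primitive [G (n x)]. *)
have near_eq : \forall y \near x, G (n x) y = G (n y) y.
  near=> y; apply: agree => //.
  by near: y; apply: lt_nbhsr; exact: nP.
have Dx := (HG (n x)).2 _ (nP x).
exact: near_eq_is_derive Dx.
Unshelve. all: by end_near. Qed.

End RealVariable.

(** * Calculus of complex-valued functions of a real variable *)

Section ComplexValued.
Context {R : realType}.
Local Notation C := (Cplx R).
Implicit Types (g h dg dh : R -> C) (x y : R) (z w : C).

Lemma Cplx_ext z w : complex.Re z = complex.Re w ->
  complex.Im z = complex.Im w -> z = w.
Proof. by case: z w => [a b] [a' b'] /= -> ->. Qed.

Lemma ReD z w : complex.Re (z + w) = complex.Re z + complex.Re w.
Proof. by case: z w => [a b] [a' b']. Qed.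
Lemma ImD z w : complex.Im (z + w) = complex.Im z + complex.Im w.
Proof. by case: z w => [a b] [a' b']. Qed.
Lemma ReN z : complex.Re (- z) = - complex.Re z.
Proof. by case: z. Qed.
Lemma ImN z : complex.Im (- z) = - complex.Im z.
Proof. by case: z. Qed.
Lemma ReM z w : complex.Re (z * w) =
  complex.Re z * complex.Re w - complex.Im z * complex.Im w.
Proof. by case: z w => [a b] [a' b']. Qed.
Lemma ImM z w : complex.Im (z * w) =
  complex.Re z * complex.Im w + complex.Im z * complex.Re w.
Proof. by case: z w => [a b] [a' b'] /=. Qed.
Lemma Re0 : complex.Re (0 : C) = 0. Proof. by []. Qed.
Lemma Im0 : complex.Im (0 : C) = 0. Proof. by []. Qed.
Lemma Re_ofR (r : R) : complex.Re (ofR r) = r. Proof. by []. Qed.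
Lemma Im_ofR (r : R) : complex.Im (ofR r) = 0. Proof. by []. Qed.

Definition ReImE := (ReD, ImD, ReN, ImN, ReM, ImM, Re0, Im0, Re_ofR, Im_ofR).

Lemma ofRD (r s : R) : ofR (r + s) = ofR r + ofR s.
Proof. by apply: Cplx_ext; rewrite !ReImE ?addr0. Qed.
Lemma ofRN (r : R) : ofR (- r) = - ofR r.
Proof. by apply: Cplx_ext; rewrite !ReImE ?oppr0. Qed.
Lemma ofRM (r s : R) : ofR (r * s) = ofR r * ofR s.
Proof. by apply: Cplx_ext; rewrite !ReImE; ring. Qed.
Lemma ofR0 : ofR 0 = 0 :> C. Proof. by []. Qed.
Lemma ofR1 : ofR 1 = 1 :> C. Proof. by []. Qed.

(* The norm of [Cplx R] takes values in [Cplx R]; [nrm] is its real version. *)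
Definition nrm z : R := Normc.normc z.

Lemma norm_nrm z : `|z| = ofR (nrm z). Proof. by []. Qed.
Lemma nrm_ge0 z : 0 <= nrm z.
Proof. by case: z => a b; exact: sqrtr_ge0. Qed.
Lemma nrmM z w : nrm (z * w) = nrm z * nrm w.
Proof. exact: Normc.normcM. Qed.
Lemma nrmD z w : nrm (z + w) <= nrm z + nrm w.
Proof. exact: le_normcD. Qed.
Lemma nrmN z : nrm (- z) = nrm z.
Proof. exact: normcN. Qed.
Lemma nrmB z w : nrm (z - w) <= nrm z + nrm w.
Proof. by rewrite -(nrmN w) nrmD. Qed.
Lemma nrm0 : nrm 0 = 0. Proof. exact: Normc.normc0. Qed.
Lemma nrm1 : nrm 1 = 1. Proof. exact: Normc.normc1. Qed.
Lemma nrmX z n : nrm (z ^+ n) = nrm z ^+ n.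
Proof. by elim: n => [|n IH]; rewrite ?expr0 ?nrm1 // !exprS nrmM IH. Qed.
Lemma nrm_ofR (r : R) : nrm (ofR r) = `|r|.
Proof. by rewrite /nrm /= expr0n addr0 sqrtr_sqr. Qed.
Lemma nrm_sum {I : Type} (s : seq I) (F : I -> C) :
  nrm (\sum_(i <- s) F i) <= \sum_(i <- s) nrm (F i).
Proof.
elim/big_ind2 : _ => [|z a w b za wb|//]; first by rewrite nrm0.
by rewrite (le_trans (nrmD _ _))// lerD.
Qed.
Lemma Re_le_nrm z : `|complex.Re z| <= nrm z.
Proof.
by case: z => a b; rewrite /nrm/= -sqrtr_sqr ler_wsqrtr// lerDl sqr_ge0.
Qed.
Lemma Im_le_nrm z : `|complex.Im z| <= nrm z.
Proof.
by case: z => a b; rewrite /nrm/= -sqrtr_sqr ler_wsqrtr// lerDr sqr_ge0.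
Qed.
Lemma nrm_le_ReIm z : nrm z <= `|complex.Re z| + `|complex.Im z|.
Proof.
case: z => a b /=; rewrite /nrm /=.
have h : 0 <= `|a| + `|b| by rewrite addr_ge0.
rewrite -[leRHS](ger0_norm h) -(sqrtr_sqr (_ + _)) ler_wsqrtr//.
by rewrite sqrrD !real_normK ?num_real// lerD2r lerDl mulrn_wge0// mulr_ge0.
Qed.

Lemma is_derive_RC_eq x g d e : d = e ->
  is_derive_RC x g d -> is_derive_RC x g e.
Proof. by move=> ->. Qed.

Lemma is_derive_RC_ext x g h d : g =1 h ->
  is_derive_RC x g d -> is_derive_RC x h d.
Proof. by move=> /funext ->. Qed.

Lemma is_derive_RC_cst x z : is_derive_RC x (fun=> z) 0.
Proof. by split; exact: is_derive_cst. Qed.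

Lemma is_derive_RCD x g h d e : is_derive_RC x g d -> is_derive_RC x h e ->
  is_derive_RC x (fun y => g y + h y) (d + e).
Proof.
move=> [g1 g2] [h1 h2]; split; rewrite !ReImE.
- by under eq_fun do rewrite ReImE; exact: is_deriveD.
- by under eq_fun do rewrite ReImE; exact: is_deriveD.
Qed.

Lemma is_derive_RCN x g d : is_derive_RC x g d ->
  is_derive_RC x (fun y => - g y) (- d).
Proof.
move=> [g1 g2]; split; rewrite !ReImE.
- by under eq_fun do rewrite ReImE; exact: is_deriveN.
- by under eq_fun do rewrite ReImE; exact: is_deriveN.
Qed.

Lemma is_derive_RCB x g h d e : is_derive_RC x g d -> is_derive_RC x h e ->
  is_derive_RC x (fun y => g y - h y) (d - e).
Proof. by move=> Hg Hh; apply: is_derive_RCD => //; exact: is_derive_RCN. Qed.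

Lemma is_derive_RCM x g h d e : is_derive_RC x g d -> is_derive_RC x h e ->
  is_derive_RC x (fun y => g y * h y) (d * h x + g x * e).
Proof.
move=> [g1 g2] [h1 h2]; split; rewrite !ReImE.
- under eq_fun do rewrite ReImE.
  apply: eq_is_derive (is_deriveB (is_deriveM g1 h1) (is_deriveM g2 h2)).
  by rewrite /GRing.scale/=; ring.
- under eq_fun do rewrite ReImE.
  apply: eq_is_derive (is_deriveD (is_deriveM g1 h2) (is_deriveM g2 h1)).
  by rewrite /GRing.scale/=; ring.
Qed.

Lemma is_derive_RC_ofR x (g : R -> R) d : is_derive x 1 g d ->
  is_derive_RC x (fun y => ofR (g y)) (ofR d).
Proof. by move=> Hg; split => //=; exact: is_derive_cst. Qed.

Lemma is_derive_RC_sum x n (g : 'I_n -> R -> C) (d : 'I_n -> C) :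
  (forall i, is_derive_RC x (g i) (d i)) ->
  is_derive_RC x (fun y => \sum_i g i y) (\sum_i d i).
Proof.
move=> H.
have E y : \sum_i g i y = (\sum_i g i) y by rewrite fct_sumE.
apply: (is_derive_RC_ext (g := \sum_i g i)) => [y|]; first by rewrite -E.
apply: (big_ind2 (fun (a : R -> C) b => is_derive_RC x a b)) => //.
  exact: is_derive_RC_cst.
by move=> a da b db; exact: is_derive_RCD.
Qed.

Lemma is_derive_RC_0_cst g : (forall x, is_derive_RC x g 0) ->
  forall x y, g x = g y.
Proof.
move=> H x y; apply: Cplx_ext.
- exact: (is_derive_0_is_cst (f := fun y => complex.Re (g y)))
    (fun x => (H x).1).
- exact: (is_derive_0_is_cst (f := fun y => complex.Im (g y)))
    (fun x => (H x).2).
Qed.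

Definition continuous_RC g :=
  continuous (fun y => complex.Re (g y)) /\
  continuous (fun y => complex.Im (g y)).

Lemma is_derive_RC_continuous g dg :
  (forall x, is_derive_RC x g (dg x)) -> continuous_RC g.
Proof.
by move=> H; split; apply: is_derive_continuous => x; have [] := H x.
Qed.

Lemma continuous_RC_cst z : continuous_RC (fun=> z).
Proof. by split; exact: cst_continuous. Qed.

Lemma continuous_RCD g h : continuous_RC g -> continuous_RC h ->
  continuous_RC (fun y => g y + h y).
Proof.
move=> [g1 g2] [h1 h2]; split => x.
- by under eq_fun do rewrite ReImE; apply: cvgD; [exact: g1|exact: h1].
- by under eq_fun do rewrite ReImE; apply: cvgD; [exact: g2|exact: h2].
Qed.

Lemma continuous_RCM g h : continuous_RC g -> continuous_RC h ->
  continuous_RC (fun y => g y * h y).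
Proof.
move=> [g1 g2] [h1 h2]; split => x.
- under eq_fun do rewrite ReImE.
  by apply: cvgB; apply: cvgM; [exact: g1|exact: h1|exact: g2|exact: h2].
- under eq_fun do rewrite ReImE.
  by apply: cvgD; apply: cvgM; [exact: g1|exact: h2|exact: g2|exact: h1].
Qed.

(** Choosing by [xget] makes the primitive a total operation; the default [cst 0] is taken only when
    no primitive exists. *)
Definition primR (g : R -> R) : R -> R :=
  xget (cst 0) [set G | G 0 = 0 /\ forall x, is_derive x 1 G (g x)].

Lemma primRP (g : R -> R) : continuous g ->
  primR g 0 = 0 /\ forall x, is_derive x 1 (primR g) (g x).
Proof.
move=> cg; have [G G0 HG] := antiderivative cg.
exact: (@xgetPex _ (cst 0)
  [set G | G 0 = 0 /\ forall x, is_derive x 1 G (g x)]) (ex_intro _ G (conj G0 HG)).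
Qed.

Definition prim g x : C :=
  (primR (fun y => complex.Re (g y)) x +i*
   primR (fun y => complex.Im (g y)) x)%C.

Lemma prim0 g : continuous_RC g -> prim g 0 = 0.
Proof. by move=> [/primRP[r _] /primRP[i _]]; rewrite /prim r i. Qed.

Lemma is_derive_prim g x : continuous_RC g -> is_derive_RC x (prim g) (g x).
Proof. by move=> [/primRP[_ r] /primRP[_ i]]; split; [exact: r|exact: i]. Qed.

Lemma eq_is_derive_RC g h d : (forall x, is_derive_RC x g (d x)) ->
  (forall x, is_derive_RC x h (d x)) -> g 0 = h 0 -> g =1 h.
Proof.
move=> Hg Hh gh0 x; apply/eqP; rewrite -subr_eq0; apply/eqP.
have H y : is_derive_RC y (fun t => g t - h t) 0.
  by apply: is_derive_RC_eq (is_derive_RCB (Hg y) (Hh y)); rewrite subrr.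
by rewrite (is_derive_RC_0_cst H x 0) gh0 subrr.
Qed.

Lemma is_derive_bound (g dg : R -> R) (T K : R) :
  (forall x, is_derive x 1 g (dg x)) -> 0 <= T ->
  (forall x, 0 <= x <= T -> `|dg x| <= K) -> `|g T - g 0| <= K * T.
Proof.
move=> Hg T0 HK.
have cg : {within `[0, T], continuous g}.
  exact/continuous_subspaceT/(is_derive_continuous Hg).
have [x] := MVT_segment T0 (fun x _ => Hg x) cg.
rewrite in_itv/= => x0T ->; rewrite subr0 normrM (ger0_norm T0).
by rewrite ler_wpM2r// HK.
Qed.

(** The mean value theorem is applied to the real and imaginary parts separately, at different
    intermediate points, which costs the factor 2. *)
Lemma is_derive_RC_bound g dg (T K : R) :
  (forall x, is_derive_RC x g (dg x)) -> 0 <= T ->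
  (forall x, 0 <= x <= T -> nrm (dg x) <= K) -> nrm (g T - g 0) <= 2 * K * T.
Proof.
move=> Hg T0 HK; apply: le_trans (nrm_le_ReIm _) _.
rewrite -mulrA mulr_natl mulr2n !ReImE lerD//.
- apply: (is_derive_bound (fun x => (Hg x).1)) => // x xT.
  exact: le_trans (Re_le_nrm _) (HK x xT).
- apply: (is_derive_bound (fun x => (Hg x).2)) => // x xT.
  exact: le_trans (Im_le_nrm _) (HK x xT).
Qed.

Lemma nrm_prim_le g (K x : R) : continuous_RC g -> 0 <= x ->
  (forall y, 0 <= y <= x -> nrm (g y) <= K) ->
  nrm (prim g x) <= 2 * K * x.
Proof.
move=> cg x0 HK; rewrite -[prim g x]subr0 -(prim0 cg).
by apply: is_derive_RC_bound HK => // y; exact: is_derive_prim.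
Qed.

Lemma continuous_nrm g : continuous_RC g -> continuous (nrm \o g).
Proof.
move=> [cr ci]; rewrite (_ : nrm \o g = fun y =>
  Num.sqrt (complex.Re (g y) ^+ 2 + complex.Im (g y) ^+ 2)); last first.
  by apply/funext => y /=; case: (g y).
move=> x; apply: continuous_comp; last exact: sqrt_continuous.
apply: cvgD; rewrite expr2; under eq_fun do rewrite expr2.
  by apply: cvgM; exact: cr.
by apply: cvgM; exact: ci.
Qed.

Lemma nrm_bounded g (T : R) : 0 <= T -> continuous_RC g ->
  exists K, forall x, 0 <= x <= T -> nrm (g x) <= K.
Proof.
move=> T0 cg.
have [|c _ H] := @EVT_max R (nrm \o g) 0 T T0.
  exact/continuous_subspaceT/continuous_nrm.
by exists (nrm (g c)) => x Hx; apply: H; rewrite in_itv.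
Qed.

Definition is_derive_mx {m n} x (A : R -> 'M[C]_(m, n)) (dA : 'M[C]_(m, n)) :=
  forall i j, is_derive_RC x (fun y => A y i j) (dA i j).

Lemma is_derive_mx_eq {m n} x (A : R -> 'M[C]_(m, n)) d e : d = e ->
  is_derive_mx x A d -> is_derive_mx x A e.
Proof. by move=> ->. Qed.

Lemma is_derive_mxM {m n p} x (A : R -> 'M[C]_(m, n)) (B : R -> 'M[C]_(n, p))
    dA dB : is_derive_mx x A dA -> is_derive_mx x B dB ->
  is_derive_mx x (fun y => A y *m B y) (dA *m B x + A x *m dB).
Proof.
move=> HA HB i j.
apply: (is_derive_RC_ext (g := fun y => \sum_k A y i k * B y k j)) => [y|].
  by rewrite mxE.
rewrite !mxE -big_split/=.
by apply: is_derive_RC_sum => k; exact: is_derive_RCM.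
Qed.

Lemma is_derive_mx_tr {m n} x (A : R -> 'M[C]_(m, n)) dA :
  is_derive_mx x A dA -> is_derive_mx x (fun y => (A y)^T) dA^T.
Proof.
move=> H i j; rewrite mxE.
by apply: is_derive_RC_ext (H j i) => y; rewrite mxE.
Qed.

Lemma is_derive_mx_0_cst {m n} (A : R -> 'M[C]_(m, n)) :
  (forall x, is_derive_mx x A 0) -> forall x y, A x = A y.
Proof.
move=> H x y; apply/matrixP => i j.
apply: (is_derive_RC_0_cst (g := fun y => A y i j)) => t.
by have := H t i j; rewrite mxE.
Qed.

End ComplexValued.

(** * Explicit algebra of 3 by 3 matrices *)

Section Matrix3.
Context {K : comNzRingType}.
Implicit Types A B : 'M[K]_3.

Definition i0 : 'I_3 := @Ordinal 3 0 isT.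
Definition i1 : 'I_3 := @Ordinal 3 1 isT.
Definition i2 : 'I_3 := @Ordinal 3 2 isT.

Lemma ord3P (P : 'I_3 -> Prop) : P i0 -> P i1 -> P i2 -> forall i, P i.
Proof.
move=> P0 P1 P2 [[|[|[|//]]] Hm].
- by rewrite (_ : Ordinal Hm = i0) //; apply/val_inj.
- by rewrite (_ : Ordinal Hm = i1) //; apply/val_inj.
- by rewrite (_ : Ordinal Hm = i2) //; apply/val_inj.
Qed.

Lemma sum3 {V : nmodType} (F : 'I_3 -> V) : \sum_i F i = F i0 + F i1 + F i2.
Proof.
rewrite !big_ord_recl big_ord0 addr0 addrA.
by congr (_ + _ + _); congr F; apply/val_inj.
Qed.

Definition mx3 (a b c d e f g h i : K) : 'M[K]_3 :=
  \matrix_(m < 3, n < 3) nth 0 (nth [::]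
    [:: [:: a; b; c]; [:: d; e; f]; [:: g; h; i]] m) n.

Definition adj3 A : 'M[K]_3 :=
  mx3 (A i1 i1 * A i2 i2 - A i1 i2 * A i2 i1)
      (A i0 i2 * A i2 i1 - A i0 i1 * A i2 i2)
      (A i0 i1 * A i1 i2 - A i0 i2 * A i1 i1)
      (A i1 i2 * A i2 i0 - A i1 i0 * A i2 i2)
      (A i0 i0 * A i2 i2 - A i0 i2 * A i2 i0)
      (A i0 i2 * A i1 i0 - A i0 i0 * A i1 i2)
      (A i1 i0 * A i2 i1 - A i1 i1 * A i2 i0)
      (A i0 i1 * A i2 i0 - A i0 i0 * A i2 i1)
      (A i0 i0 * A i1 i1 - A i0 i1 * A i1 i0).

Lemma adj3_1 : adj3 1%:M = 1%:M.
Proof.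
apply/matrixP; elim/ord3P; elim/ord3P; rewrite !mxE /=;
  rewrite ?(mulr0, mul0r, mulr1, subr0, subrr) //.
Qed.

Lemma det_mx3 A : \det A =
  A i0 i0 * (A i1 i1 * A i2 i2 - A i1 i2 * A i2 i1)
  - A i0 i1 * (A i1 i0 * A i2 i2 - A i1 i2 * A i2 i0)
  + A i0 i2 * (A i1 i0 * A i2 i1 - A i1 i1 * A i2 i0).
Proof.
pose a m n := A (inord m) (inord n).
have aE i j : A i j = a i j by rewrite /a !inord_val.
rewrite (expand_det_row _ ord0) !big_ord_recl big_ord0 /cofactor.
rewrite !(expand_det_row _ ord0) !big_ord_recl !big_ord0 /cofactor !det_mx11.
rewrite !mxE !aE /= /bump /=; ring.
Qed.

Lemma det_sub_scalar3 A (l : K) : \det (A - l%:M) =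
  - l ^+ 3 + \tr A * l ^+ 2 - \tr (adj3 A) * l + \det A.
Proof. by rewrite !det_mx3 /mxtrace !sum3 !mxE /=; ring. Qed.

Lemma mul_adj3 A : adj3 A *m A = (\det A)%:M.
Proof.
rewrite det_mx3; apply/matrixP.
by elim/ord3P; elim/ord3P; rewrite !mxE !sum3 !mxE /=; ring.
Qed.

(** The differential of [adj3] at [A] in the direction [B]: [m] is the product rule applied to one 2
    by 2 minor. *)
Definition dadj3 A B : 'M[K]_3 :=
  let m i j k l r s t u := (B i j * A k l + A i j * B k l)
                         - (B r s * A t u + A r s * B t u) in
  mx3 (m i1 i1 i2 i2 i1 i2 i2 i1) (m i0 i2 i2 i1 i0 i1 i2 i2)
      (m i0 i1 i1 i2 i0 i2 i1 i1) (m i1 i2 i2 i0 i1 i0 i2 i2)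
      (m i0 i0 i2 i2 i0 i2 i2 i0) (m i0 i2 i1 i0 i0 i0 i1 i2)
      (m i1 i0 i2 i1 i1 i1 i2 i0) (m i0 i1 i2 i0 i0 i0 i2 i1)
      (m i0 i0 i1 i1 i0 i1 i1 i0).

Definition companion (m p : K) := mx3 0 1 0 0 0 1 m p 0.

(** If [A' = H A], then [(adj A)' = (tr H) adj A - (adj A) H]; a companion matrix of this shape is
    traceless, which leaves the second term. *)
Lemma dadj3_companion A m p :
  dadj3 A (companion m p *m A) = - (adj3 A *m companion m p).
Proof.
by apply/matrixP; elim/ord3P; elim/ord3P; rewrite !mxE !sum3 !mxE /=; ring.
Qed.

(** With [A = Psi(mu)] and [B = Phi(nu)] the left-hand side is the derivative of [Psi(mu) Phi(nu)]
    in [x]. The two companion matrices differ only in the lower left entry, which collapses the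
    product to one term. *)
Lemma companion_diff A B m n p k j :
  (- (A *m companion m p) *m B + A *m (companion n p *m B)) k j =
  A k i2 * (n - m) * B i0 j.
Proof.
have E : companion n p - companion m p = mx3 0 0 0 0 0 0 (n - m) 0 0.
  by apply/matrixP; elim/ord3P; elim/ord3P; rewrite !mxE /=; ring.
by rewrite mulNmx -mulmxA addrC -mulmxBr -mulmxBl E !mxE !sum3 !mxE !sum3 !mxE /=; ring.
Qed.

(** Sends a solution of the adjoint system with last entry [w] to [(w', w'', w''')]; here [p] stands
    for [- f'(u) + c] and [m] for the spectral parameter. *)
Definition symplectic (p m : K) := mx3 0 (- 1) 0 1 0 p 0 (- p) m.

(** When [p' = dp], the right-hand side is the derivative of [S = symplectic p m], so this is the
    differential equation [S' = H(- m) S + S H(m)^T]. *)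
Lemma symplecticP p dp m :
  companion (m + dp) p *m symplectic p m +
  symplectic p m *m (companion (- m + dp) p)^T =
  mx3 0 0 0 0 0 dp 0 (- dp) 0.
Proof.
by apply/matrixP; elim/ord3P; elim/ord3P; rewrite !mxE !sum3 !mxE /=; ring.
Qed.

(** The derivative of [P S Q^T] when [P' = - P H], [Q' = - Q G] and [S' = H S + S G^T]. *)
Lemma conj_cancel (P H S G Q : 'M[K]_3) :
  (- (P *m H) *m S + P *m (H *m S + S *m G^T)) *m Q^T
  + P *m S *m (- (Q *m G))^T = 0.
Proof.
by rewrite mulNmx mulmxDr !mulmxA addKr linearN /= trmx_mul mulmxN mulmxA subrr.
Qed.

Lemma det_symplectic p m : \det (symplectic p m) = m.
Proof. by rewrite det_mx3 !mxE /=; ring. Qed.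

End Matrix3.

Lemma is_derive_mx3 {R : realType} (x : R)
    (a b c d e f g h i : R -> Cplx R) a' b' c' d' e' f' g' h' i' :
  is_derive_RC x a a' -> is_derive_RC x b b' -> is_derive_RC x c c' ->
  is_derive_RC x d d' -> is_derive_RC x e e' -> is_derive_RC x f f' ->
  is_derive_RC x g g' -> is_derive_RC x h h' -> is_derive_RC x i i' ->
  is_derive_mx x (fun y => mx3 (a y) (b y) (c y) (d y) (e y) (f y)
    (g y) (h y) (i y)) (mx3 a' b' c' d' e' f' g' h' i').
Proof.
by do 9!move=> ?; elim/ord3P; elim/ord3P; rewrite mxE /=;
  under eq_fun do rewrite mxE /=.
Qed.

Lemma is_derive_adj3 {R : realType} (x : R) (A : R -> 'M[Cplx R]_3) dA :
  is_derive_mx x A dA ->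
  is_derive_mx x (fun y => adj3 (A y)) (dadj3 (A x) dA).
Proof.
by move=> D; apply: is_derive_mx3; apply: is_derive_RCB;
  apply: is_derive_RCM; exact: D.
Qed.

(** * The inverse fundamental matrix and the symmetry between [mu] and [- mu] *)

Section Monodromy.
Context {R : realType}.
Local Notation C := (Cplx R).
Context (q dq : R -> R) (Phi : R -> C -> 'M[C]_3).

Definition Hq x (mu : C) : 'M[C]_3 := companion (- mu + ofR (dq x)) (ofR (q x)).

Hypothesis Phi0 : forall mu, Phi 0 mu = 1%:M.
Hypothesis dPhi : forall mu x,
  is_derive_mx x (Phi^~ mu) (Hq x mu *m Phi x mu).

Definition Psi x mu := adj3 (Phi x mu).

Lemma Psi0 mu : Psi 0 mu = 1%:M.
Proof. by rewrite /Psi Phi0 adj3_1. Qed.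

Lemma dPsi mu x : is_derive_mx x (Psi^~ mu) (- (Psi x mu *m Hq x mu)).
Proof.
apply: is_derive_mx_eq (is_derive_adj3 (dPhi mu x)).
exact: dadj3_companion.
Qed.

Lemma mulPsiPhi x mu : Psi x mu *m Phi x mu = 1%:M.
Proof.
have H y : is_derive_mx y (fun y => Psi y mu *m Phi y mu) 0.
  apply: is_derive_mx_eq (is_derive_mxM (dPsi mu y) (dPhi mu y)).
  by rewrite mulNmx mulmxA addNr.
by rewrite (is_derive_mx_0_cst H x 0) Psi0 Phi0 mul1mx.
Qed.

Lemma mulPhiPsi x mu : Phi x mu *m Psi x mu = 1%:M.
Proof. exact/mulmx1C/mulPsiPhi. Qed.

(** Liouville's formula for a traceless system, read off from the adjugate identity because the
    adjugate is already known to be the inverse. *)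
Lemma det_Phi x mu : \det (Phi x mu) = 1.
Proof.
have := mul_adj3 (Phi x mu); rewrite -/(Psi x mu) mulPsiPhi.
by move/matrixP/(_ i0 i0); rewrite !mxE.
Qed.

Lemma det_Phi_sub x mu l : \det (Phi x mu - l%:M) =
  - l ^+ 3 + \tr (Phi x mu) * l ^+ 2 - \tr (Psi x mu) * l + 1.
Proof. by rewrite det_sub_scalar3 det_Phi. Qed.

(* [symp x mu] maps solutions of the adjoint system at [mu] to solutions of
   the system at [- mu]. *)
Definition symp x (mu : C) : 'M[C]_3 := symplectic (ofR (q x)) mu.

Hypothesis dqP : forall x : R, is_derive x 1 q (dq x).

Lemma dsymp x mu : is_derive_mx x (symp^~ mu)
  (Hq x (- mu) *m symp x mu + symp x mu *m (Hq x mu)^T).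
Proof.
have D := is_derive_RC_ofR (dqP x); have DN := is_derive_RCN D.
rewrite /Hq opprK symplecticP.
by apply: is_derive_mx3 => //; exact: is_derive_RC_cst.
Qed.

(** The columns of [(Psi x mu)^T] are adjoint solutions at [mu], [symp] turns them into solutions at
    [- mu], and [Psi x (- mu)] undoes the flow of the latter: the product is conserved. *)
Lemma symp_conj x mu :
  Psi x (- mu) *m symp x mu *m (Psi x mu)^T = symp 0 mu.
Proof.
have H y : is_derive_mx y
    (fun y => Psi y (- mu) *m symp y mu *m (Psi y mu)^T) 0.
  apply: is_derive_mx_eq (is_derive_mxM
    (is_derive_mxM (dPsi (- mu) y) (dsymp y mu)) (is_derive_mx_tr (dPsi mu y))).
  exact: conj_cancel.
by rewrite (is_derive_mx_0_cst H x 0) !Psi0 trmx1 mulmx1 mul1mx.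
Qed.

Lemma det_symp x mu : \det (symp x mu) = mu.
Proof. exact: det_symplectic. Qed.

Context (T : R).
Hypothesis qT : q T = q 0.

(** Over a period the conservation law becomes a similarity between [(Psi T mu)^T] and
    [Phi T (- mu)], with conjugating matrix [symp 0 mu]. Its determinant is [mu], whence the
    exclusion of 0. *)
Lemma tr_Psi_period mu : mu != 0 -> \tr (Psi T mu) = \tr (Phi T (- mu)).
Proof.
move=> mu0; have := symp_conj T mu.
have -> : symp T mu = symp 0 mu by rewrite /symp qT.
move=> E; have U : symp 0 mu \in unitmx by rewrite unitmxE det_symp unitfE.
have {}E : symp 0 mu *m (Psi T mu)^T = Phi T (- mu) *m symp 0 mu.
  by rewrite -[X in Phi _ _ *m X]E !mulmxA mulPhiPsi mul1mx.
rewrite -mxtrace_tr -[(Psi T mu)^T](mulKmx U) E mulmxA mxtrace_mulC mulmxA.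
by rewrite mulmxV// mul1mx.
Qed.

End Monodromy.

(** * Differentiability of the flow in the spectral parameter *)

Section ParameterDependence.
Context {R : realType}.
Local Notation C := (Cplx R).
Context (q dq : R -> R) (Phi : R -> C -> 'M[C]_3).
Hypothesis Phi0 : forall mu, Phi 0 mu = 1%:M.
Hypothesis dPhi : forall mu x,
  is_derive_mx x (Phi^~ mu) (Hq q dq x mu *m Phi x mu).
Context (T : R).
Hypothesis T0 : 0 <= T.

Local Notation Psi := (Psi Phi).
Implicit Types (g h : R -> C -> C) (mu nu : C) (x y : R).

Let T00 : 0 <= (0 : R) <= T.
Proof. by rewrite lexx. Qed.

Lemma continuous_Phi mu i j : continuous_RC (fun x => Phi x mu i j).
Proof. apply: is_derive_RC_continuous => x; exact: dPhi. Qed.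

Lemma continuous_Psi mu i j : continuous_RC (fun x => Psi x mu i j).
Proof. apply: is_derive_RC_continuous => x; exact: (dPsi dPhi). Qed.

(** Variation of constants: the entries of [Phi(mu) int Psi(mu) J Phi(nu)], where [J] has the single
    nonzero entry [- 1], in the lower left corner. At [nu = mu] this is the derivative of [Phi] in
    [mu]. *)
Definition volterra mu nu i j x : C :=
  \sum_k Phi x mu i k * prim (fun y => - Psi y mu k i2 * Phi y nu i0 j) x.

Lemma continuous_kernel mu nu k j :
  continuous_RC (fun y => - Psi y mu k i2 * Phi y nu i0 j).
Proof.
apply: continuous_RCM; last exact: continuous_Phi.
under eq_fun do rewrite -mulN1r.
by apply: continuous_RCM; [exact: continuous_RC_cst|exact: continuous_Psi].
Qed.

Lemma PhiB mu nu i j x :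
  Phi x nu i j - Phi x mu i j = (nu - mu) * volterra mu nu i j x.
Proof.
(* Both sides vanish at [x = 0] and have the same derivative; multiplication by [Phi x mu] on the
   left then gives the claim. *)
have W k : (Psi x mu *m Phi x nu) k j - (1%:M : 'M[C]_3) k j =
    (nu - mu) * prim (fun y => - Psi y mu k i2 * Phi y nu i0 j) x.
  apply: (eq_is_derive_RC
    (g := fun x => (Psi x mu *m Phi x nu) k j - (1%:M : 'M[C]_3) k j)
    (h := fun x => (nu - mu) *
      prim (fun y => - Psi y mu k i2 * Phi y nu i0 j) x)
    (d := fun x => (nu - mu) * (- Psi x mu k i2 * Phi x nu i0 j))).
  - move=> y; apply: is_derive_RC_eq (is_derive_RCB
      (is_derive_mxM (dPsi dPhi mu y) (dPhi nu y) k j)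
      (is_derive_RC_cst y ((1%:M : 'M[C]_3) k j))).
    by rewrite companion_diff subr0; ring.
  - move=> y; apply: is_derive_RC_eq (is_derive_RCM (is_derive_RC_cst y _)
      (is_derive_prim y (continuous_kernel mu nu k j))).
    by rewrite mul0r add0r.
  - rewrite (Psi0 Phi0) Phi0 mul1mx subrr prim0 ?mulr0 //.
    exact: continuous_kernel.
have -> : Phi x nu i j - Phi x mu i j = (Phi x mu *m
    (Psi x mu *m Phi x nu - 1%:M)) i j.
  by rewrite mulmxBr mulmxA (mulPhiPsi Phi0 dPhi) mul1mx mulmx1 [RHS]mxE
     [in RHS]mxE.
rewrite mxE /volterra mulr_sumr; apply: eq_bigr => k _.
by rewrite mxE [X in _ * (_ + X)]mxE W mulrCA.
Qed.

(** The 6 is three summands times the factor 2 of [nrm_prim_le]. Leaving [G] free makes the estimate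
    serve both for [volterra] and for a difference of two of its values. *)
Lemma volterra_bound (P : 'I_3 -> C) (A : R -> 'I_3 -> C) (G : R -> C)
    (a b c x : R) :
  (forall k, continuous_RC (fun y => - A y k * G y)) -> 0 <= x <= T ->
  (forall k, nrm (P k) <= b) ->
  (forall k y, 0 <= y <= T -> nrm (A y k) <= a) ->
  (forall y, 0 <= y <= T -> nrm (G y) <= c) ->
  nrm (\sum_k P k * prim (fun y => - A y k * G y) x) <= 6 * a * b * c * T.
Proof.
move=> cAG /andP[x0 xT] Pb Aa Gc.
have b0 : 0 <= b := le_trans (nrm_ge0 _) (Pb i0).
have a0 : 0 <= a := le_trans (nrm_ge0 _) (Aa i0 0 T00).
have c0 : 0 <= c := le_trans (nrm_ge0 _) (Gc 0 T00).
have Q k : nrm (prim (fun y => - A y k * G y) x) <= 2 * (a * c) * T.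
  apply: (@le_trans _ _ (2 * (a * c) * x)); last first.
    by rewrite ler_wpM2l // mulr_ge0 // mulr_ge0.
  apply: nrm_prim_le => // y /andP[y0 yx].
  have yT : 0 <= y <= T by rewrite y0 (le_trans yx).
  by rewrite nrmM nrmN ler_pM ?nrm_ge0 ?Aa ?Gc.
apply: le_trans (nrm_sum _ _) _.
apply: (@le_trans _ _ (\sum_(k < 3) b * (2 * (a * c) * T))).
  by apply: ler_sum => k _; rewrite nrmM ler_pM ?nrm_ge0.
by rewrite sum3 le_eqVlt; apply/orP; left; apply/eqP; ring.
Qed.

Lemma nrm_volterra_bound mu nu i j x (a b c : R) : 0 <= x <= T ->
  (forall k, nrm (Phi x mu i k) <= b) ->
  (forall k y, 0 <= y <= T -> nrm (Psi y mu k i2) <= a) ->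
  (forall y, 0 <= y <= T -> nrm (Phi y nu i0 j) <= c) ->
  nrm (volterra mu nu i j x) <= 6 * a * b * c * T.
Proof.
by move=> xT Hb Ha Hc; apply: volterra_bound => // k; exact: continuous_kernel.
Qed.

Lemma Phi_bounded_at mu : exists2 B, 0 <= B & forall x i j, 0 <= x <= T ->
  nrm (Phi x mu i j) <= B /\ nrm (Psi x mu i j) <= B.
Proof.
have /choice[B HB] : forall ij : 'I_3 * 'I_3, exists B, forall x, 0 <= x <= T ->
    nrm (Phi x mu ij.1 ij.2) <= B /\ nrm (Psi x mu ij.1 ij.2) <= B.
  move=> [i j]; have [B1 H1] := nrm_bounded T0 (continuous_Phi mu i j).
  have [B2 H2] := nrm_bounded T0 (continuous_Psi mu i j).
  exists (Num.max B1 B2) => x xT /=.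
  by rewrite !le_max H1 // H2 // orbT.
have B0 ij : 0 <= B ij.
  by have [h _] := HB ij 0 T00; exact: le_trans (nrm_ge0 _) h.
have BS i j : B (i, j) <= \sum_ij B ij.
  by rewrite (bigD1 (i, j)) //= lerDl sumr_ge0.
exists (\sum_ij B ij); first by rewrite sumr_ge0.
move=> x i j xT; have [h1 h2] := HB (i, j) x xT.
by split; [apply: le_trans h1 _|apply: le_trans h2 _].
Qed.

(* On a ball where the Volterra operator has norm at most 1/2, the maximum [m]
   of an entry of the first row satisfies [m <= B + m / 2]. *)
Lemma Phi_bounded mu0 : exists2 rho, 0 < rho & exists2 B, 0 <= B &
  forall nu x i j, nrm (nu - mu0) <= rho -> 0 <= x <= T ->
  nrm (Phi x nu i j) <= B.
Proof.
have [B B0 HB] := Phi_bounded_at mu0.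
pose L := 6 * B * B * T.
have L0 : 0 <= L by rewrite /L !mulr_ge0.
exists (2 * (L + 1))^-1; first by rewrite invr_gt0; lra.
exists (2 * B) => [|nu x i j]; first by rewrite mulr_ge0.
set rho := _^-1 => nurho.
have rhoL : rho * L <= 2^-1.
  rewrite /rho ler_pdivrMl; last lra.
  by lra.
(* Only the first row of [Phi] enters the Volterra kernel, so a bound on that row controls every
   row. *)
have step m j' : (forall y, 0 <= y <= T -> nrm (Phi y nu i0 j') <= m) ->
    forall y i', 0 <= y <= T -> nrm (Phi y nu i' j') <= B + m / 2.
  move=> Hm y i' yT.
  have m0 : 0 <= m by apply: le_trans (nrm_ge0 _) (Hm y yT).
  have V : nrm (volterra mu0 nu i' j' y) <= 6 * B * B * m * T.
    apply: nrm_volterra_bound => // [k|k z zT]; first by have [] := HB y i' k yT.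
    by have [] := HB z k i2 zT.
  rewrite -(subrK (Phi y mu0 i' j') (Phi y nu i' j')) PhiB.
  apply: le_trans (nrmD _ _) _; rewrite addrC lerD //.
    by have [] := HB y i' j' yT.
  rewrite nrmM; apply: (@le_trans _ _ (rho * (L * m))).
    rewrite ler_pM ?nrm_ge0 //; apply: le_trans V _.
    by rewrite le_eqVlt; apply/orP; left; apply/eqP; rewrite /L; ring.
  by rewrite mulrA [leRHS]mulrC ler_wpM2r.
move=> xT.
have [|c cT Hc] := @EVT_max R (nrm \o (fun y => Phi y nu i0 j)) 0 T T0.
  exact/continuous_subspaceT/continuous_nrm/continuous_Phi.
rewrite in_itv/= in cT.
have Hm y : 0 <= y <= T -> nrm (Phi y nu i0 j) <= nrm (Phi c nu i0 j).
  by move=> yT; apply: Hc; rewrite in_itv.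
(* At the maximum point [c] this gives [m <= 2 B]; the second use of [step] carries the bound over
   to row [i]. *)
have m2 := step _ _ Hm c i0 cT.
have := step _ _ Hm x i xT; lra.
Qed.

(** Differentiability in [mu] with a quadratic remainder, uniform in [x] on the period and in the
    base point [mu] near [mu0]. The uniformity in [x] lets the property pass through primitives. *)
Definition tame g g' := forall mu0, exists2 rho, 0 < rho & exists K,
  forall x mu nu, 0 <= x <= T -> nrm (mu - mu0) <= rho -> nrm (nu - mu0) <= rho ->
  [/\ nrm (g x mu) <= K, nrm (g' x mu) <= K &
      nrm (g x nu - g x mu - (nu - mu) * g' x mu) <= K * nrm (nu - mu) ^+ 2].

(** A common radius and constant for two functions; capping the radius at 1/2 ensures
    [nrm (nu - mu) <= 1], which the product rule uses. *)
Lemma tame2 g g' h h' mu0 : tame g g' -> tame h h' ->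
  exists2 rho, 0 < rho & exists2 K, 0 <= K &
  forall x mu nu, 0 <= x <= T -> nrm (mu - mu0) <= rho -> nrm (nu - mu0) <= rho ->
  [/\ nrm (nu - mu) <= 1,
  [/\ nrm (g x mu) <= K, nrm (g' x mu) <= K &
      nrm (g x nu - g x mu - (nu - mu) * g' x mu) <= K * nrm (nu - mu) ^+ 2]
  & [/\ nrm (h x mu) <= K, nrm (h' x mu) <= K &
      nrm (h x nu - h x mu - (nu - mu) * h' x mu) <= K * nrm (nu - mu) ^+ 2]].
Proof.
move=> /(_ mu0)[r1 r10 [K1 H1]] /(_ mu0)[r2 r20 [K2 H2]].
exists (Num.min 2^-1 (Num.min r1 r2)).
  by rewrite !lt_min r10 r20 invr_gt0 ltr0Sn.
exists (Num.max 0 (Num.max K1 K2)); first by rewrite le_max lexx.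
move=> x mu nu xT; rewrite !le_min => /and3P[m0 m1 m2] /and3P[n0 n1 n2].
have d2 : 0 <= nrm (nu - mu) ^+ 2 by rewrite sqr_ge0.
have [a1 b1 c1] := H1 x mu nu xT m1 n1.
have [a2 b2 c2] := H2 x mu nu xT m2 n2.
have K1K : K1 <= Num.max 0 (Num.max K1 K2) by rewrite !le_max lexx orbT.
have K2K : K2 <= Num.max 0 (Num.max K1 K2) by rewrite !le_max lexx !orbT.
split.
- have -> : nu - mu = (nu - mu0) - (mu - mu0) by ring.
  by apply: le_trans (nrmB _ _) _; lra.
- by split; [exact: le_trans a1 K1K|exact: le_trans b1 K1K|
    exact: le_trans c1 (ler_wpM2r d2 K1K)].
- by split; [exact: le_trans a2 K2K|exact: le_trans b2 K2K|
    exact: le_trans c2 (ler_wpM2r d2 K2K)].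
Qed.

Lemma tame_cst (z : C) : tame (fun _ _ => z) (fun _ _ => 0).
Proof.
move=> mu0; exists 1 => //; exists (nrm z) => x mu nu _ _ _; split => //.
  by rewrite nrm0 nrm_ge0.
by rewrite mulr0 subr0 subrr nrm0 mulr_ge0 ?sqr_ge0 ?nrm_ge0.
Qed.

Lemma tameD g g' h h' : tame g g' -> tame h h' ->
  tame (fun x mu => g x mu + h x mu) (fun x mu => g' x mu + h' x mu).
Proof.
move=> tg th mu0; have [r r0 [K K0 H]] := tame2 mu0 tg th.
exists r => //; exists (2 * K) => x mu nu xT mr nr.
have [_ [a1 b1 c1] [a2 b2 c2]] := H x mu nu xT mr nr.
split; first by apply: le_trans (nrmD _ _) _; lra.
  by apply: le_trans (nrmD _ _) _; lra.
have -> : g x nu + h x nu - (g x mu + h x mu) - (nu - mu) * (g' x mu + h' x mu)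
  = (g x nu - g x mu - (nu - mu) * g' x mu)
  + (h x nu - h x mu - (nu - mu) * h' x mu) by ring.
by apply: le_trans (nrmD _ _) _; lra.
Qed.

Lemma tameM g g' h h' : tame g g' -> tame h h' ->
  tame (fun x mu => g x mu * h x mu)
       (fun x mu => g' x mu * h x mu + g x mu * h' x mu).
Proof.
move=> tg th mu0; have [r r0 [K K0 H]] := tame2 mu0 tg th.
exists r => //; exists (K ^+ 2 + 4 * K ^+ 2) => x mu nu xT mr nr.
have [d1 [a1 b1 c1] [a2 b2 c2]] := H x mu nu xT mr nr.
have [_ _ [a3 _ _]] := H x nu nu xT nr nr.
have KK z w : nrm z <= K -> nrm w <= K -> nrm (z * w) <= K ^+ 2.
  by move=> zK wK; rewrite nrmM expr2 ler_pM ?nrm_ge0.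
have K2 : 0 <= K ^+ 2 by rewrite sqr_ge0.
split; first by have := KK _ _ a1 a2; lra.
  apply: le_trans (nrmD _ _) _.
  by have := KK _ _ b1 a2; have := KK _ _ a1 b2; lra.
set d := nu - mu in d1 c1 c2 *.
set rg := g x nu - _ - _ in c1; set rh := h x nu - _ - _ in c2.
(* The remainder of the product splits into three terms, bounded by [K ^+ 2], [2 * K ^+ 2] and
   [K ^+ 2] times [nrm d ^+ 2]. *)
have -> : g x nu * h x nu - g x mu * h x mu
    - d * (g' x mu * h x mu + g x mu * h' x mu)
  = rg * h x nu + (g x mu + d * g' x mu) * rh + d ^+ 2 * (g' x mu * h' x mu).
  by rewrite /rg /rh; ring.
have D2 : 0 <= nrm d ^+ 2 by rewrite sqr_ge0.
have e1 : nrm (rg * h x nu) <= K * nrm d ^+ 2 * K.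
  by rewrite nrmM ler_pM ?nrm_ge0.
have e2 : nrm ((g x mu + d * g' x mu) * rh) <= (K + K) * (K * nrm d ^+ 2).
  rewrite nrmM ler_pM ?nrm_ge0 //; apply: le_trans (nrmD _ _) _.
  by rewrite lerD // nrmM -[leRHS]mul1r ler_pM ?nrm_ge0.
have e3 : nrm (d ^+ 2 * (g' x mu * h' x mu)) <= nrm d ^+ 2 * K ^+ 2.
  by rewrite nrmM nrmX ler_wpM2l // KK.
apply: le_trans (nrmD _ _) _.
have := nrmD (rg * h x nu) ((g x mu + d * g' x mu) * rh).
have KD : 0 <= K ^+ 2 * nrm d ^+ 2 by rewrite mulr_ge0.
have -> : (K ^+ 2 + 4 * K ^+ 2) * nrm d ^+ 2 = K * nrm d ^+ 2 * K +
  (K + K) * (K * nrm d ^+ 2) + nrm d ^+ 2 * K ^+ 2 + K ^+ 2 * nrm d ^+ 2 by ring.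
lra.
Qed.

Lemma primB (g h : R -> C) x : continuous_RC g -> continuous_RC h ->
  continuous_RC (fun y => g y - h y) ->
  prim g x - prim h x = prim (fun y => g y - h y) x.
Proof.
move=> cg ch cgh.
apply: (eq_is_derive_RC (g := fun x => prim g x - prim h x)
  (d := fun x => g x - h x)) => [y|y|].
- exact: is_derive_RCB (is_derive_prim y cg) (is_derive_prim y ch).
- exact: is_derive_prim.
- by rewrite !prim0 // subr0.
Qed.

(** The remainder of the primitive is the primitive of the remainder [e], which is bounded uniformly
    on the interval of integration. *)
Lemma tame_prim g g' : tame g g' ->
  (forall mu, continuous_RC (g^~ mu)) -> (forall mu, continuous_RC (g'^~ mu)) ->
  tame (fun x mu => prim (g^~ mu) x) (fun x mu => prim (g'^~ mu) x).
Proof.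
move=> tg cg cg' mu0; have [r r0 [K K0 H]] := tame2 mu0 tg tg.
exists r => //; exists (2 * K * T) => x mu nu xT mr nr.
have /andP[x0 xT'] := xT.
have sub y : 0 <= y <= x -> 0 <= y <= T.
  by move=> /andP[-> yx]; exact: le_trans yx xT'.
have up c : 0 <= c -> 2 * c * x <= 2 * c * T.
  by move=> c0; rewrite ler_wpM2l // mulr_ge0.
split.
- apply: le_trans (up _ K0); apply: nrm_prim_le => // y /sub yT.
  by have [_ []] := H y mu nu yT mr nr.
- apply: le_trans (up _ K0); apply: nrm_prim_le => // y /sub yT.
  by have [_ []] := H y mu nu yT mr nr.
pose e y := g y nu - g y mu - (nu - mu) * g' y mu.
have De y : is_derive_RC y (fun x => prim (g^~ nu) x - prim (g^~ mu) x
    - (nu - mu) * prim (g'^~ mu) x) (e y).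
  apply: is_derive_RC_eq (is_derive_RCB (is_derive_RCB
    (is_derive_prim y (cg nu)) (is_derive_prim y (cg mu)))
    (is_derive_RCM (is_derive_RC_cst y _) (is_derive_prim y (cg' mu)))).
  by rewrite mul0r add0r.
have ce : continuous_RC e.
  apply: continuous_RCD; first apply: continuous_RCD => //.
    by under eq_fun do rewrite -mulN1r; apply: continuous_RCM => //;
       exact: continuous_RC_cst.
  under eq_fun do rewrite -mulNr.
  by apply: continuous_RCM => //; exact: continuous_RC_cst.
rewrite (eq_is_derive_RC De (h := prim e)) => [|y|]; first last.
- by rewrite !prim0 // !subr0 mulr0 subr0.
- exact: is_derive_prim.
have D2 : 0 <= K * nrm (nu - mu) ^+ 2 by rewrite mulr_ge0 ?sqr_ge0.
apply: (@le_trans _ _ (2 * (K * nrm (nu - mu) ^+ 2) * T)); last first.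
  by rewrite le_eqVlt; apply/orP; left; apply/eqP; ring.
apply: le_trans (up _ D2); apply: nrm_prim_le => // y /sub yT.
by have [_ []] := H y mu nu yT mr nr.
Qed.

Lemma nrm_Psi_le mu x i j B : (forall i j, nrm (Phi x mu i j) <= B) ->
  nrm (Psi x mu i j) <= 2 * (B * B).
Proof.
move=> HB.
have m a b c d e f k l : nrm (Phi x mu a b * Phi x mu c d -
    Phi x mu e f * Phi x mu k l) <= 2 * (B * B).
  apply: le_trans (nrmB _ _) _; rewrite !nrmM mulr_natl mulr2n.
  by rewrite lerD // ler_pM ?nrm_ge0.
by move: i j; elim/ord3P; elim/ord3P; rewrite mxE /=; exact: m.
Qed.

(** By [PhiB] the remainder is [nu - mu] times [volterra mu nu - volterra mu mu]; applying [PhiB]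
    again inside the kernel produces a second factor [nu - mu]. *)
Lemma tame_Phi i j :
  tame (fun x mu => Phi x mu i j) (fun x mu => volterra mu mu i j x).
Proof.
move=> mu0; have [rho rho0 [B B0 HB]] := Phi_bounded mu0.
exists rho => //.
have HP mu x k l : nrm (mu - mu0) <= rho -> 0 <= x <= T ->
    nrm (Psi x mu k l) <= 2 * (B * B).
  by move=> mr xT; apply: nrm_Psi_le => *; exact: HB.
pose L := 6 * (2 * (B * B)) * B * B * T.
have L0 : 0 <= L by rewrite /L !mulr_ge0.
have HV mu nu x k l : nrm (mu - mu0) <= rho -> nrm (nu - mu0) <= rho ->
    0 <= x <= T -> nrm (volterra mu nu k l x) <= L.
  move=> mr nr xT; apply: nrm_volterra_bound => // *.
  - exact: HB.
  - exact: HP.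
  - exact: HB.
pose M := 6 * (2 * (B * B)) * B * L * T.
have M0 : 0 <= M by rewrite /M !mulr_ge0.
exists (B + L + M) => x mu nu xT mr nr; split.
- by have := HB mu x i j mr xT; lra.
- by have := HV mu mu x i j mr mr xT; lra.
rewrite PhiB -mulrBr nrmM.
have cd k : continuous_RC
    (fun y => - Psi y mu k i2 * (Phi y nu i0 j - Phi y mu i0 j)).
  apply: continuous_RCM.
    under eq_fun do rewrite -mulN1r.
    by apply: continuous_RCM; [exact: continuous_RC_cst|exact: continuous_Psi].
  apply: continuous_RCD; first exact: continuous_Phi.
  under eq_fun do rewrite -mulN1r.
  by apply: continuous_RCM; [exact: continuous_RC_cst|exact: continuous_Phi].
have -> : volterra mu nu i j x - volterra mu mu i j x = \sum_k Phi x mu i k *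
    prim (fun y => - Psi y mu k i2 * (Phi y nu i0 j - Phi y mu i0 j)) x.
  rewrite /volterra -sumrB; apply: eq_bigr => k _.
  have E : (fun y => - Psi y mu k i2 * (Phi y nu i0 j - Phi y mu i0 j)) =
    (fun y => - Psi y mu k i2 * Phi y nu i0 j - - Psi y mu k i2 * Phi y mu i0 j).
    by apply/funext => y; rewrite mulrBr.
  rewrite -mulrBr primB ?E //; try exact: continuous_kernel.
  by rewrite -E.
have V : nrm (\sum_k Phi x mu i k *
    prim (fun y => - Psi y mu k i2 * (Phi y nu i0 j - Phi y mu i0 j)) x) <=
    6 * (2 * (B * B)) * B * (nrm (nu - mu) * L) * T.
  apply: (volterra_bound (A := fun y k => Psi y mu k i2)) => // [k|k y yT|y yT].
  - exact: HB.
  - exact: HP.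
  - by rewrite PhiB nrmM ler_wpM2l ?nrm_ge0 // HV.
apply: (@le_trans _ _ (M * nrm (nu - mu) ^+ 2)); last first.
  by rewrite ler_wpM2r ?sqr_ge0 //; lra.
apply: le_trans (ler_wpM2l (nrm_ge0 _) V) _.
by rewrite le_eqVlt; apply/orP; left; apply/eqP; rewrite /M; ring.
Qed.

(** Members are functions of both variables: a primitive in [x] involves the whole interval, so
    evaluation at [T] must wait until the derivatives in [mu] are built. *)
Inductive flow_alg : (R -> C -> C) -> Prop :=
| flow_alg_Phi i j : flow_alg (fun x mu => Phi x mu i j)
| flow_alg_cst z : flow_alg (fun _ _ => z)
| flow_algD g h : flow_alg g -> flow_alg h ->
    flow_alg (fun x mu => g x mu + h x mu)
| flow_algM g h : flow_alg g -> flow_alg h ->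
    flow_alg (fun x mu => g x mu * h x mu)
| flow_alg_prim g : flow_alg g -> flow_alg (fun x mu => prim (g^~ mu) x).

Lemma flow_alg_continuous g mu : flow_alg g -> continuous_RC (g^~ mu).
Proof.
elim=> [i j|z|{}g h _ cg _ ch|{}g h _ cg _ ch|{}g _ cg].
- exact: continuous_Phi.
- exact: continuous_RC_cst.
- exact: continuous_RCD.
- exact: continuous_RCM.
- by apply: is_derive_RC_continuous => x; exact: is_derive_prim.
Qed.

Lemma flow_algN g : flow_alg g -> flow_alg (fun x mu => - g x mu).
Proof.
move=> Hg; rewrite (_ : (fun x mu => _) = fun x mu => - 1 * g x mu).
  by apply: flow_algM => //; exact: flow_alg_cst.
by apply/funext => x; apply/funext => mu; rewrite mulN1r.
Qed.

Lemma flow_alg_Psi i j : flow_alg (fun x mu => Psi x mu i j).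
Proof.
have m a b c d e f k l : flow_alg (fun x mu => Phi x mu a b * Phi x mu c d -
    Phi x mu e f * Phi x mu k l).
  apply: flow_algD; first by apply: flow_algM; exact: flow_alg_Phi.
  by apply: flow_algN; apply: flow_algM; exact: flow_alg_Phi.
by move: i j; elim/ord3P; elim/ord3P;
  under eq_fun do under eq_fun do rewrite mxE /=; exact: m.
Qed.

Lemma flow_alg_volterra i j : flow_alg (fun x mu => volterra mu mu i j x).
Proof.
rewrite /volterra; under eq_fun do under eq_fun do rewrite sum3.
have s k : flow_alg (fun x mu => Phi x mu i k *
    prim (fun y => - Psi y mu k i2 * Phi y mu i0 j) x).
  apply: flow_algM; first exact: flow_alg_Phi.
  apply: (flow_alg_prim (g := fun y mu => - Psi y mu k i2 * Phi y mu i0 j)).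
  apply: flow_algM; last exact: flow_alg_Phi.
  by apply: flow_algN; exact: flow_alg_Psi.
by do 2![apply: flow_algD => //].
Qed.

Lemma flow_alg_tame g : flow_alg g -> exists2 g', flow_alg g' & tame g g'.
Proof.
elim=> [i j|z|{}g h ag [g' ag' tg] ah [h' ah' th]|
  {}g h ag [g' ag' tg] ah [h' ah' th]|{}g ag [g' ag' tg]].
- exists (fun x mu => volterra mu mu i j x); first exact: flow_alg_volterra.
  exact: tame_Phi.
- exists (fun _ _ => 0); first exact: flow_alg_cst.
  exact: tame_cst.
- by exists (fun x mu => g' x mu + h' x mu); [exact: flow_algD|exact: tameD].
- exists (fun x mu => g' x mu * h x mu + g x mu * h' x mu).
    by apply: flow_algD; exact: flow_algM.
  exact: tameM.
- exists (fun x mu => prim (g'^~ mu) x); first exact: flow_alg_prim.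
  by apply: tame_prim => // mu; exact: flow_alg_continuous.
Qed.

End ParameterDependence.

(** * Complex derivatives, Taylor estimates and the exponential *)

Lemma quad_is_derive {K : numFieldType} {V : normedModType K} (f : K -> V)
    (x : K) (d : V) (rho k : K) : 0 < rho -> 0 <= k ->
  (forall h, `|h| <= rho -> `|f (h + x) - f x - h *: d| <= k * `|h| ^+ 2) ->
  is_derive x 1 f d.
Proof.
move=> rho0 k0 H.
have L : (h^-1 *: (f (h *: 1 + x) - f x)) @[h --> 0^'] --> d.
  apply/cvgrPdist_le => e e0; near=> h.
  have h0 : h != 0 by near: h; exact: nbhs_dnbhs_neq.
  have hr : `|h| <= rho by near: h; exact: dnbhs0_le.
  (* The difference quotient is within [k * |h|] of [d]; dividing by [k + 1] also covers [k = 0]. *)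
  have he : `|h| <= e / (k + 1).
    by near: h; apply: dnbhs0_le; rewrite divr_gt0 // ltr_wpDl.
  have -> : d - h^-1 *: (f (h *: 1 + x) - f x) =
      - (h^-1 *: (f (h + x) - f x - h *: d)).
    rewrite [h%:A]mulr1 [in RHS]scalerBr scalerA mulVf // scale1r.
    by rewrite opprB.
  rewrite normrN normrZ normfV ler_pdivrMl ?normr_gt0 //.
  apply: le_trans (H h hr) _; rewrite expr2 mulrCA ler_wpM2l //.
  apply: (@le_trans _ _ (k * (e / (k + 1)))); first by rewrite ler_wpM2l.
  rewrite mulrCA -{2}[e]mulr1 ler_wpM2l ?(ltW e0) // ler_pdivrMr ?ltr_wpDl //.
  by rewrite mul1r lerDl.
by apply: DeriveDef; [apply/cvg_ex; exists d|exact/cvg_lim].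
Unshelve. all: by end_near. Qed.

Section ComplexDerivative.
Context {R : realType}.
Local Notation C := (Cplx R).
Implicit Types (g : C -> C) (z w : C).

Lemma le_ofR (r s : R) : (ofR r <= ofR s) = (r <= s).
Proof. by rewrite /ofR lecR. Qed.

(** Complex differentiability strengthened to a quadratic remainder, with radius and constant
    depending on the point. *)
Definition cderiv g g' := forall z, exists2 rho : R, 0 < rho & exists2 K,
  0 <= K & forall w, nrm (w - z) <= rho ->
  nrm (g w - g z - (w - z) * g' z) <= K * nrm (w - z) ^+ 2.

Lemma mx_norm_le {m n} (A : 'M[C]_(m, n)) (k : C) : 0 <= k ->
  (forall i j, `|A i j| <= k) -> `|A| <= k.
Proof.
move=> k0 H; rewrite -[`|A|]/(mx_norm A).
have [->//|/mx_norm_neq0[ij ->]] := eqVneq (mx_norm A) 0.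
exact: H.
Qed.

Lemma derive1_cderiv_mx {m n} (M M' : C -> 'M[C]_(m, n)) :
  (forall i j, cderiv (fun z => M z i j) (fun z => M' z i j)) ->
  derive1 M = M'.
Proof.
move=> H; apply/funext => z.
have /choice[rK HrK] : forall ij : 'I_m * 'I_n, exists rK : R * R,
    [/\ 0 < rK.1, 0 <= rK.2 & forall w, nrm (w - z) <= rK.1 ->
    nrm (M w ij.1 ij.2 - M z ij.1 ij.2 - (w - z) * M' z ij.1 ij.2) <=
    rK.2 * nrm (w - z) ^+ 2].
  by move=> [i j]; have [r r0 [K K0 h]] := H i j z; exists (r, K).
have r0 ij : 0 < (rK ij).1 by have [] := HrK ij.
have K0 ij : 0 <= (rK ij).2 by have [] := HrK ij.
(* [(S + 1)^-1] is positive and lies below each of the finitely many entrywise radii. *)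
pose S := \sum_ij (rK ij).1^-1.
have S0 : 0 <= S by rewrite sumr_ge0 // => ij _; rewrite invr_ge0 ltW.
have rS ij : (S + 1)^-1 <= (rK ij).1.
  rewrite invf_ple ?posrE //; last by rewrite ltr_wpDl.
  rewrite /S (bigD1 ij) //= -addrA lerDl addr_ge0 // sumr_ge0 // => kl _.
  by rewrite invr_ge0 ltW.
have D : is_derive z 1 M (M' z).
  apply: (@quad_is_derive _ _ M z (M' z) (ofR (S + 1)^-1)
    (ofR (\sum_ij (rK ij).2))).
  - by rewrite ltcR invr_gt0 ltr_wpDl.
  - by rewrite lecR sumr_ge0.
  move=> h; rewrite norm_nrm le_ofR => hS.
  rewrite -[ofR _ ^+ 2]rmorphXn -ofRM.
  apply: mx_norm_le => [|i j].
    by rewrite lecR mulr_ge0 ?sqr_ge0 ?sumr_ge0.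
  rewrite !mxE norm_nrm le_ofR.
  have [_ _ /(_ (h + z))] := HrK (i, j); rewrite /= addrK => /(_ _)/le_trans; apply.
    exact: le_trans hS (rS (i, j)).
  rewrite ler_wpM2r ?sqr_ge0 //.
  by rewrite (bigD1 (i, j)) //= lerDl sumr_ge0.
by rewrite derive1E; exact: derive_val.
Qed.

Lemma is_derive_RC_quad (x : R) (g : R -> C) (d : C) (rho K : R) :
  0 < rho -> 0 <= K ->
  (forall h, `|h| <= rho -> nrm (g (h + x) - g x - ofR h * d) <= K * `|h| ^+ 2) ->
  is_derive_RC x g d.
Proof.
move=> rho0 K0 H; split; apply: (quad_is_derive rho0 K0) => h hr.
- apply: le_trans (H h hr); apply: le_trans (Re_le_nrm _).
  by rewrite !ReImE mul0r subr0.
- apply: le_trans (H h hr); apply: le_trans (Im_le_nrm _).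
  by rewrite !ReImE mul0r addr0.
Qed.

(** Restriction to the ray through [z] reduces estimates in the complex plane to mean value
    estimates in a real variable. *)
Lemma cderiv_radial g g' z x : cderiv g g' ->
  is_derive_RC x (fun t : R => g (ofR t * z)) (z * g' (ofR x * z)).
Proof.
move=> /(_ (ofR x * z))[rho rho0 [K K0 H]].
have N0 := nrm_ge0 z.
have N1 : 0 < nrm z + 1 by rewrite ltr_wpDl.
apply: (@is_derive_RC_quad _ _ _ (rho / (nrm z + 1)) (K * nrm z ^+ 2)).
- by rewrite divr_gt0.
- by rewrite mulr_ge0 ?sqr_ge0.
move=> h; rewrite ler_pdivlMr // => hr.
have E : ofR (h + x) * z - ofR x * z = ofR h * z by rewrite ofRD; ring.
have hz : nrm (ofR h * z) <= rho.
  by rewrite nrmM nrm_ofR; apply: le_trans hr; rewrite ler_wpM2l // lerDl.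
have := H (ofR (h + x) * z); rewrite E => /(_ hz).
by rewrite nrmM nrm_ofR mulrA exprMn [`|h| ^+ 2 * _]mulrC mulrA.
Qed.

(** Integrating [g'] along the segment from 0 to [z] raises the order of vanishing by one. *)
Lemma cderiv_bound g g' n (rho K : R) : cderiv g g' -> g 0 = 0 ->
  (forall z, nrm z <= rho -> nrm (g' z) <= K * nrm z ^+ n) ->
  forall z, nrm z <= rho -> nrm (g z) <= 2 * K * nrm z ^+ n.+1.
Proof.
move=> Hg g0 HK z zr.
have N0 := nrm_ge0 z.
have K0 : 0 <= K * nrm z ^+ n by apply: le_trans (nrm_ge0 _) (HK z zr).
have := @is_derive_RC_bound _ (fun t : R => g (ofR t * z))
  (fun t => z * g' (ofR t * z)) 1 (K * nrm z ^+ n.+1)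
  (fun x => cderiv_radial z x Hg) ler01 _.
rewrite ofR0 ofR1 mul1r mul0r g0 subr0 mulr1 mulrA; apply => x /andP[x0 x1].
have nx : nrm (ofR x * z) = x * nrm z by rewrite nrmM nrm_ofR ger0_norm.
have xr : x * nrm z <= nrm z by rewrite ler_piMl.
rewrite nrmM exprS mulrCA ler_wpM2l //.
apply: le_trans (HK _ _) _; rewrite nx; first exact: le_trans xr zr.
rewrite exprMn mulrCA ler_piMl // exprn_ile1 //.
Qed.

(** The parameters are the derivatives at 0 of orders one to three. The constant term is omitted so
    that the derivative is [a + cubic b c 0], of the same shape. *)
Definition cubic (a b c z : C) : C := a * z + b * z ^+ 2 / 2 + c * z ^+ 3 / 6.

Lemma cderiv_sub_cubic g g' (e a b c : C) : cderiv g g' ->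
  cderiv (fun z => g z - e - cubic a b c z) (fun z => g' z - a - cubic b c 0 z).
Proof.
move=> Hg z; have [r r0 [K K0 H]] := Hg z.
exists (Num.min 1 r); first by rewrite lt_min ltr01 r0.
exists (K + (nrm (b / 2) + nrm (c / 6) * (1 + nrm (3 * z)))).
  by rewrite !addr_ge0 ?mulr_ge0 ?addr_ge0 ?nrm_ge0.
move=> w; rewrite le_min => /andP[w1 wr].
have -> : g w - e - cubic a b c w - (g z - e - cubic a b c z)
    - (w - z) * (g' z - a - cubic b c 0 z) =
  (g w - g z - (w - z) * g' z)
  - (b / 2 + c / 6 * ((w - z) + 3 * z)) * (w - z) ^+ 2.
  by rewrite /cubic; field.
apply: le_trans (nrmB _ _) _; rewrite [leRHS]mulrDl lerD ?H //.
rewrite nrmM nrmX ler_wpM2r ?sqr_ge0 //.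
apply: le_trans (nrmD _ _) _; rewrite lerD // nrmM ler_wpM2l ?nrm_ge0 //.
by apply: le_trans (nrmD _ _) _; rewrite lerD.
Qed.

(** The derivative [g4] makes [g3 - g3 0] of order one at 0; three integrations along rays by
    [cderiv_bound] raise this to order four. *)
Lemma taylor3 g0 g1 g2 g3 g4 :
  cderiv g0 g1 -> cderiv g1 g2 -> cderiv g2 g3 -> cderiv g3 g4 ->
  exists2 rho : R, 0 < rho & exists2 K, 0 <= K & forall z, nrm z <= rho ->
  nrm (g0 z - g0 0 - cubic (g1 0) (g2 0) (g3 0) z) <= K * nrm z ^+ 4.
Proof.
move=> H0 H1 H2 H3.
have [r r0 [K K0 H]] := H3 0.
have c0 a b c : cubic a b c 0 = 0.
  by rewrite /cubic !expr0n /= !mulr0 !mul0r !addr0.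
pose L := K * r + nrm (g4 0).
have L0 : 0 <= L by rewrite addr_ge0 ?mulr_ge0 ?(ltW r0) ?nrm_ge0.
have B3 z : nrm z <= r -> nrm (g3 z - g3 0 - cubic 0 0 0 z) <= L * nrm z ^+ 1.
  move=> zr; rewrite /cubic !mul0r !addr0 subr0 expr1.
  have := H z; rewrite subr0 => /(_ zr) h.
  rewrite -(subrK (z * g4 0) (g3 z - g3 0)); apply: le_trans (nrmD _ _) _.
  rewrite nrmM /L mulrDl [nrm z * _]mulrC lerD2r.
  apply: le_trans h _; rewrite expr2 -mulrA ler_wpM2l //.
  by rewrite ler_wpM2r ?nrm_ge0.
have step f f' n (b c : C) M : cderiv f f' ->
    (forall z, nrm z <= r ->
      nrm (f' z - f' 0 - cubic b c 0 z) <= M * nrm z ^+ n) ->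
    forall z, nrm z <= r -> nrm (f z - f 0 - cubic (f' 0) b c z) <=
      2 * M * nrm z ^+ n.+1.
  move=> Hf HM; apply: (cderiv_bound (cderiv_sub_cubic _ _ _ _ Hf)).
    by rewrite c0 subr0 subrr.
  exact: HM.
exists r => //; exists (2 * (2 * (2 * L))); first by rewrite !mulr_ge0.
apply: (step _ _ 3) => //.
apply: (step _ _ 2) => //.
exact: (step _ _ 1).
Qed.

Lemma nrm_expC z : nrm (expC z) = expR (complex.Re z).
Proof.
have -> : expC z = ofR (expR (complex.Re z)) *
    (cos (complex.Im z) +i* sin (complex.Im z))%C.
  rewrite /expC; congr (_ * _); apply: Cplx_ext; rewrite !ReImE /= /iC /=; ring.
rewrite nrmM nrm_ofR ger0_norm ?expR_ge0 // /nrm /= cos2Dsin2 sqrtr1.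
by rewrite mulr1.
Qed.

Lemma is_derive_expC_radial z (x : R) :
  is_derive_RC x (fun t => expC (ofR t * z)) (z * expC (ofR x * z)).
Proof.
pose a := complex.Re z; pose b := complex.Im z.
have Da : is_derive x 1 (fun t : R => t * a) a.
  apply: eq_is_derive (is_deriveM (is_derive_id x 1) (is_derive_cst a x 1)).
  by rewrite scaler0 add0r [LHS]mulr1.
have Db : is_derive x 1 (fun t : R => t * b) b.
  apply: eq_is_derive (is_deriveM (is_derive_id x 1) (is_derive_cst b x 1)).
  by rewrite scaler0 add0r [LHS]mulr1.
have De := @is_derive1_comp R expR (fun t => t * a) x _ _ (is_derive_expR _) Da.
have Dc := @is_derive1_comp R cos (fun t => t * b) x _ _ (is_derive_cos _) Db.
have Ds := @is_derive1_comp R sin (fun t => t * b) x _ _ (is_derive_sin _) Db.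
have P t : expC (ofR t * z) =
    ofR ((expR \o (fun t => t * a)) t) *
    (ofR ((cos \o (fun t => t * b)) t) + iC * ofR ((sin \o (fun t => t * b)) t)).
  by rewrite /expC !ReImE !mul0r subr0 addr0.
apply: is_derive_RC_ext (fun t => esym (P t)) _.
apply: is_derive_RC_eq (is_derive_RCM (is_derive_RC_ofR De)
  (is_derive_RCD (is_derive_RC_ofR Dc) (is_derive_RCM (is_derive_RC_cst x iC)
    (is_derive_RC_ofR Ds)))).
have Im_iC : complex.Im (iC : C) = 1 by [].
by rewrite P /=; apply: Cplx_ext; rewrite !ReImE -/a -/b Im_iC; ring.
Qed.

Lemma expC0 : expC (0 : C) = 1.
Proof.
by rewrite /expC /= expR0 cos0 sin0 ofR0 mulr0 addr0 ofR1 mulr1.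
Qed.

Lemma expC_sub1_le z : nrm z <= 1 -> nrm (expC z - 1) <= 2 * expR 1 * nrm z.
Proof.
move=> z1; have := @is_derive_RC_bound _ (fun t : R => expC (ofR t * z))
  (fun t => z * expC (ofR t * z)) 1 (expR 1 * nrm z)
  (is_derive_expC_radial z) ler01 _.
rewrite ofR0 ofR1 mul1r mul0r expC0 mulr1 mulrA; apply.
move=> x /andP[x0 x1]; rewrite nrmM [leLHS]mulrC ler_wpM2r ?nrm_ge0 // nrm_expC.
rewrite ler_expR; apply: le_trans (ler_norm _) _; apply: le_trans (Re_le_nrm _) _.
by rewrite nrmM nrm_ofR ger0_norm // mulr_ile1 ?nrm_ge0.
Qed.

(** Along the ray through [z], [expC - id] has derivative [z * (expC - 1)], so integrating the
    first-order bound gives the second-order one. *)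
Lemma expC_sub_le z : nrm z <= 1 ->
  nrm (expC z - 1 - z) <= 4 * expR 1 * nrm z ^+ 2.
Proof.
move=> z1; have D x : is_derive_RC x (fun t : R => expC (ofR t * z) - ofR t * z)
    (z * (expC (ofR x * z) - 1)).
  have Di := is_derive_RC_ofR (is_derive_id x 1).
  apply: is_derive_RC_eq (is_derive_RCB (is_derive_expC_radial z x)
    (is_derive_RCM Di (is_derive_RC_cst x z))).
  by rewrite ofR1; ring.
have := @is_derive_RC_bound _ _ _ 1 (nrm z * (2 * expR 1 * nrm z)) D ler01 _.
rewrite ofR0 ofR1 mul1r mul0r expC0 mulr1 subr0.
rewrite [expC z - z - 1]addrAC.
have -> : 2 * (nrm z * (2 * expR 1 * nrm z)) = 4 * expR 1 * nrm z ^+ 2 by ring.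
apply => x /andP[x0 x1].
have xz : nrm (ofR x * z) <= nrm z.
  by rewrite nrmM nrm_ofR ger0_norm // ler_piMl ?nrm_ge0.
rewrite nrmM ler_wpM2l ?nrm_ge0 //; apply: le_trans (expC_sub1_le _) _.
  exact: le_trans xz z1.
by rewrite ler_wpM2l // mulr_ge0 ?expR_ge0.
Qed.

End ComplexDerivative.

(** * The monodromy matrix and its first derivative at [mu = 0] *)

Section ZeroSpectralParameter.

Lemma companion_right {K : comNzRingType} (v w p dp : K) :
  mx3 w 0 0 (p * v) 0 0 (dp * v + p * w) 0 0 =
  companion (- 0 + dp) p *m mx3 v 0 0 w 0 0 (p * v) 0 0.
Proof.
by apply/matrixP; elim/ord3P; elim/ord3P; rewrite !mxE !sum3 !mxE /=; ring.
Qed.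

Lemma companion_left {K : comNzRingType} (u v w p dp : K) :
  mx3 (- dp) 0 0 (p * v - (v * p + u * dp)) (- w) v 0 0 0 =
  - (mx3 (- p) 0 1 (w - u * p) (- v) u 0 0 0 *m companion (- 0 + dp) p).
Proof.
by apply/matrixP; elim/ord3P; elim/ord3P; rewrite !mxE !sum3 !mxE /=; ring.
Qed.

(** The first hypothesis says that [M] fixes the column [e1]. The two nonzero rows in the second
    span [e0] and [e2], since [k != 0], so [M] also fixes these as row vectors; only the middle row
    stays partly free. *)
Lemma matrix_fixing {K : fieldType} (M : 'M[K]_3) (u p k : K) : k != 0 ->
  M *m mx3 0 0 0 k 0 0 0 0 0 = mx3 0 0 0 k 0 0 0 0 0 ->
  mx3 (- p) 0 1 (k - u * p) 0 u 0 0 0 *m M =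
    mx3 (- p) 0 1 (k - u * p) 0 u 0 0 0 ->
  M = mx3 1 0 0 (M i1 i0) 1 (M i1 i2) 0 0 1.
Proof.
move=> k0 /matrixP HR /matrixP HL.
have R i : M i i1 * k = mx3 0 0 0 k 0 0 0 0 0 i i0.
  by rewrite -HR mxE sum3 !mxE /=; ring.
move: HL; set L := mx3 (- p) _ _ _ _ _ _ _ _ => HL.
have E0 j : - p * M i0 j + M i2 j = L i0 j.
  by rewrite -HL mxE sum3 !mxE /=; ring.
have E1 j : (k - u * p) * M i0 j + u * M i2 j = L i1 j.
  by rewrite -HL mxE sum3 !mxE /=; ring.
have M0 j : M i0 j = (j == i0)%:R.
  apply: (mulfI k0).
  have -> : k * M i0 j = L i1 j - u * L i0 j by rewrite -E0 -E1; ring.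
  by move: j; elim/ord3P; rewrite !mxE /=; ring.
have M2 j : M i2 j = (j == i2)%:R.
  have -> : M i2 j = L i0 j + p * M i0 j by rewrite -E0; ring.
  by rewrite M0; move: j; elim/ord3P; rewrite !mxE /=; ring.
have M11 : M i1 i1 = 1.
  by apply: (mulIf k0); rewrite R mxE mul1r.
apply/matrixP; elim/ord3P; elim/ord3P; rewrite [RHS]mxE /= ?M0 ?M2 ?M11 //.
Qed.

Lemma tr_shear {K : comNzRingType} (a b : K) :
  \tr (mx3 1 0 0 a 1 b 0 0 1) = 3.
Proof. by rewrite /mxtrace sum3 !mxE /=; ring. Qed.

Lemma tr_adj_shear {K : comNzRingType} (a b : K) :
  \tr (adj3 (mx3 1 0 0 a 1 b 0 0 1)) = 3.
Proof. by rewrite /mxtrace sum3 !mxE /=; ring. Qed.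

Lemma mul_right_entry {K : comNzRingType} (P : 'M[K]_3) (k a b c : K) :
  P *m mx3 0 0 0 k 0 0 0 0 0 = mx3 a 0 0 b 0 0 c 0 0 -> P i0 i1 * k = a.
Proof.
move=> /matrixP/(_ i0 i0); rewrite mxE sum3 !mxE /= => <-; ring.
Qed.

Lemma mul_left_entries {K : comNzRingType} (P : 'M[K]_3)
    (k u0 p0 u p b c : K) :
  mx3 (- p0) 0 1 (k - u0 * p0) 0 u0 0 0 0 *m P = mx3 (- p) 0 1 b c u 0 0 0 ->
  P i0 i2 * k = u - u0 /\ P i2 i2 = 1 + p0 * P i0 i2.
Proof.
move=> /matrixP E; move: (E i0 i2) (E i1 i2).
rewrite !mxE !sum3 !mxE /= => e0 <-.
have -> : P i2 i2 = 1 + p0 * P i0 i2 by rewrite -{1}e0; ring.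
by split; ring.
Qed.

(** The double sum is minus the entry [(0, 2)] of [P M Q]. Writing [M] as the identity plus [e1]
    times the row [(a, 0, b)], the identity contributes nothing because [P Q] has entry 0 there. *)
Lemma shear_conj_entry {K : comNzRingType} (P Q : 'M[K]_3) (a b : K)
    (M := mx3 1 0 0 a 1 b 0 0 1) : P *m Q = 1%:M ->
  \sum_i \sum_l M i l * (- Q l i2 * P i0 i) =
  - (P i0 i1 * (a * Q i0 i2 + b * Q i2 i2)).
Proof.
move=> /matrixP/(_ i0 i2); rewrite mxE sum3 mxE /= => E.
rewrite !sum3 !mxE /=.
transitivity (- (P i0 i0 * Q i0 i2 + P i0 i1 * Q i1 i2 + P i0 i2 * Q i2 i2)
  - P i0 i1 * (a * Q i0 i2 + b * Q i2 i2)); first ring.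
by rewrite E; ring.
Qed.

Context {R : realType}.
Local Notation C := (Cplx R).
Context (u v w q dq : R -> R) (Phi : R -> C -> 'M[C]_3).
Hypothesis Phi0 : forall mu, Phi 0 mu = 1%:M.
Hypothesis dPhi : forall mu x,
  is_derive_mx x (Phi^~ mu) (Hq q dq x mu *m Phi x mu).
Hypothesis du : forall x : R, is_derive x 1 u (v x).
Hypothesis dv : forall x : R, is_derive x 1 v (w x).
Hypothesis dw : forall x : R, is_derive x 1 w (q x * v x).
Hypothesis dqP : forall x : R, is_derive x 1 q (dq x).

(** The solution [(u', u'', u''')] at [mu = 0], padded with zero columns to keep all matrices
    square. *)
Definition right_sol x : 'M[C]_3 :=
  mx3 (ofR (v x)) 0 0 (ofR (w x)) 0 0 (ofR (q x) * ofR (v x)) 0 0.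

(** The nonzero rows are the first integrals [y'' - q y] and [u (y'' - q y) - u' y' + u'' y],
    obtained by integrating [1] and [u] against [(y'' - q y)']. *)
Definition left_sol x : 'M[C]_3 :=
  mx3 (- ofR (q x)) 0 1 (ofR (w x) - ofR (u x) * ofR (q x)) (- ofR (v x))
    (ofR (u x)) 0 0 0.

Lemma d_right_sol x : is_derive_mx x right_sol (Hq q dq x 0 *m right_sol x).
Proof.
have Dv := is_derive_RC_ofR (dv x).
have Dw := is_derive_RC_ofR (dw x); have Dq := is_derive_RC_ofR (dqP x).
rewrite /Hq -companion_right -ofRM.
by apply: is_derive_mx3 => //; try exact: is_derive_RC_cst; exact: is_derive_RCM.
Qed.

Lemma d_left_sol x : is_derive_mx x left_sol (- (left_sol x *m Hq q dq x 0)).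
Proof.
have Du := is_derive_RC_ofR (du x); have Dv := is_derive_RC_ofR (dv x).
have Dw := is_derive_RC_ofR (dw x); have Dq := is_derive_RC_ofR (dqP x).
rewrite /Hq -companion_left -ofRM.
apply: is_derive_mx3 => //; try exact: is_derive_RC_cst;
  try exact: is_derive_RCN.
by apply: is_derive_RCB => //; exact: is_derive_RCM.
Qed.

Lemma Phi_right_sol x : Phi x 0 *m right_sol 0 = right_sol x.
Proof.
have H y : is_derive_mx y (fun y => Psi Phi y 0 *m right_sol y) 0.
  apply: is_derive_mx_eq (is_derive_mxM (dPsi dPhi 0 y) (d_right_sol y)).
  by rewrite mulNmx mulmxA addNr.
have := is_derive_mx_0_cst H x 0; rewrite (Psi0 Phi0) mul1mx => <-.
by rewrite mulmxA (mulPhiPsi Phi0 dPhi) mul1mx.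
Qed.

Lemma left_sol_Phi x : left_sol x *m Phi x 0 = left_sol 0.
Proof.
have H y : is_derive_mx y (fun y => left_sol y *m Phi y 0) 0.
  apply: is_derive_mx_eq (is_derive_mxM (d_left_sol y) (dPhi 0 y)).
  by rewrite mulNmx mulmxA addNr.
by rewrite (is_derive_mx_0_cst H x 0) Phi0 mulmx1.
Qed.

Context (T : R).
Hypothesis uT : u T = u 0.
Hypothesis vT : v T = v 0.
Hypothesis wT : w T = w 0.
Hypothesis qT : q T = q 0.
Hypothesis v0 : v 0 = 0.
Hypothesis w0 : w 0 != 0.

Let k : C := ofR (w 0).
Let k0 : k != 0.
Proof.
apply: contra w0 => /eqP E; have := congr1 (@complex.Re _) E.
by rewrite Re_ofR => ->.
Qed.

Let right0 : right_sol 0 = mx3 0 0 0 k 0 0 0 0 0.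
Proof. by rewrite /right_sol v0 ofR0 mulr0. Qed.

Let left0 : left_sol 0 = mx3 (- ofR (q 0)) 0 1 (k - ofR (u 0) * ofR (q 0)) 0
  (ofR (u 0)) 0 0 0.
Proof. by rewrite /left_sol v0 ofR0 oppr0. Qed.

Lemma monodromy0 : Phi T 0 =
  mx3 1 0 0 (Phi T 0 i1 i0) 1 (Phi T 0 i1 i2) 0 0 1.
Proof.
have rT : right_sol T = right_sol 0 by rewrite /right_sol vT wT qT.
have lT : left_sol T = left_sol 0 by rewrite /left_sol uT vT wT qT.
apply: (matrix_fixing k0 (u := ofR (u 0)) (p := ofR (q 0))).
  by rewrite -right0 Phi_right_sol rT.
by rewrite -left0 -{1}lT left_sol_Phi.
Qed.

Lemma tr_monodromy0 : \tr (Phi T 0) = 3.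
Proof. by rewrite monodromy0 tr_shear. Qed.

Lemma tr_Psi_monodromy0 : \tr (Psi Phi T 0) = 3.
Proof. by rewrite /Psi monodromy0 tr_adj_shear. Qed.

(** The sum is [tr M_mu(0)]. Its integrand is [- p' * (m1 * p + m3 * (1 + q(0) * p))] with
    [p = (u - u(0)) / u''(0)], the derivative of a polynomial in the periodic function [p]. *)
Lemma tr_volterra0 : \sum_i volterra Phi 0 0 i i T = 0.
Proof.
pose p x : C := ofR (u x - u 0) / k.
pose m1 := Phi T 0 i1 i0; pose m3 := Phi T 0 i1 i2.
pose P i j x := prim (fun y => - Psi Phi y 0 i i2 * Phi y 0 i0 j) x.
have Phi01 x : Phi x 0 i0 i1 = ofR (v x) / k.
  have := Phi_right_sol x; rewrite right0 => /mul_right_entry E.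
  by apply: (mulIf k0); rewrite divfK.
have LPsi x : left_sol 0 *m Psi Phi x 0 = left_sol x.
  by rewrite -(left_sol_Phi x) -mulmxA (mulPhiPsi Phi0 dPhi) mulmx1.
have [Psi02 Psi22] : (forall x, Psi Phi x 0 i0 i2 = p x) /\
    (forall x, Psi Phi x 0 i2 i2 = 1 + ofR (q 0) * p x).
  have E x : Psi Phi x 0 i0 i2 = p x /\
      Psi Phi x 0 i2 i2 = 1 + ofR (q 0) * p x.
    have := LPsi x; rewrite left0 => /mul_left_entries[e0 e2].
    have e02 : Psi Phi x 0 i0 i2 = p x.
      by apply: (mulIf k0); rewrite e0 /p divfK // ofRD ofRN.
    by rewrite e2 e02.
  by split => x; have [] := E x.
have dp x : is_derive_RC x p (ofR (v x) / k).
  have Du := is_deriveB (du x) (is_derive_cst (u 0) x 1).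
  apply: is_derive_RC_eq (is_derive_RCM (is_derive_RC_ofR Du)
    (is_derive_RC_cst x k^-1)).
  by rewrite subr0 mulr0 addr0.
pose h x := \sum_i \sum_l Phi T 0 i l * P l i x.
(* The explicit primitive of the integrand is added with the opposite sign, so that the sum is
   constant; both terms in [p] vanish at 0 and at [T]. *)
have dh x : is_derive_RC x
    (fun x => h x + (m3 * p x + (m1 + ofR (q 0) * m3) / 2 * (p x * p x))) 0.
  have DP i l : is_derive_RC x (fun x => Phi T 0 i l * P l i x)
      (Phi T 0 i l * (- Psi Phi x 0 l i2 * Phi x 0 i0 i)).
    apply: is_derive_RC_eq (is_derive_RCM (is_derive_RC_cst x _)
      (is_derive_prim x (continuous_kernel dPhi 0 0 l i))).
    by rewrite mul0r add0r.
  have Dh : is_derive_RC x h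
      (\sum_i \sum_l Phi T 0 i l * (- Psi Phi x 0 l i2 * Phi x 0 i0 i)).
    by apply: is_derive_RC_sum => i; apply: is_derive_RC_sum.
  apply: is_derive_RC_eq (is_derive_RCD Dh (is_derive_RCD
    (is_derive_RCM (is_derive_RC_cst x m3) (dp x))
    (is_derive_RCM (is_derive_RC_cst x _) (is_derive_RCM (dp x) (dp x))))).
  rewrite monodromy0 (shear_conj_entry _ _ (mulPhiPsi Phi0 dPhi x 0)).
  rewrite Phi01 Psi02 Psi22 -/m1 -/m3; field.
  exact: k0.
have := is_derive_RC_0_cst dh T 0.
have pT : p T = 0 by rewrite /p uT subrr ofR0 mul0r.
have p0 : p 0 = 0 by rewrite /p subrr ofR0 mul0r.
have h0 : h 0 = 0.
  rewrite /h big1 // => i _; rewrite big1 // => l _.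
  by rewrite /P prim0 ?mulr0 //; exact: continuous_kernel.
by rewrite pT p0 h0 !mulr0 !addr0.
Qed.

End ZeroSpectralParameter.

(** * Orders of vanishing at the origin and expansion of the characteristic polynomial *)

Section OrderOfVanishing.
Context {R : realType}.
Local Notation C := (Cplx R).
Implicit Types (F G : C * C -> C) (q : C * C).

Definition max_nrm q : R := Num.max (nrm q.1) (nrm q.2).

Lemma max_nrm_ge0 q : 0 <= max_nrm q.
Proof. by rewrite /max_nrm le_max nrm_ge0. Qed.

Lemma norm_max_nrm q : `|q| = ofR (max_nrm q).
Proof.
rewrite prod_normE !norm_nrm /max_nrm.
have [h|h] := leP (nrm q.1) (nrm q.2).
  by rewrite [LHS]max_r // le_ofR.
by rewrite [LHS]max_l // le_ofR ltW.
Qed.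

Definition vanishes n F := exists2 rho : R, 0 < rho & exists2 K, 0 <= K &
  forall q, max_nrm q <= rho -> nrm (F q) <= K * max_nrm q ^+ n.

Lemma vanishesD n F G : vanishes n F -> vanishes n G ->
  vanishes n (fun q => F q + G q).
Proof.
move=> [r r0 [K K0 H]] [s s0 [L L0 I]].
exists (Num.min r s); first by rewrite lt_min r0.
exists (K + L) => [|q]; first by rewrite addr_ge0.
rewrite le_min => /andP[qr qs]; rewrite mulrDl.
by apply: le_trans (nrmD _ _) _; rewrite lerD ?H ?I.
Qed.

Lemma vanishesM n m F G : vanishes n F -> vanishes m G ->
  vanishes (n + m) (fun q => F q * G q).
Proof.
move=> [r r0 [K K0 H]] [s s0 [L L0 I]].
exists (Num.min r s); first by rewrite lt_min r0.
exists (K * L) => [|q]; first by rewrite mulr_ge0.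
rewrite le_min => /andP[qr qs]; rewrite exprD mulrACA nrmM.
by rewrite ler_pM ?nrm_ge0 ?H ?I.
Qed.

Lemma vanishes_cst (z : C) : vanishes 0 (fun=> z).
Proof.
exists 1 => //; exists (nrm z) => [|q _]; first exact: nrm_ge0.
by rewrite expr0 mulr1.
Qed.

Lemma vanishesZ n (z : C) F : vanishes n F -> vanishes n (fun q => z * F q).
Proof. exact: (vanishesM (vanishes_cst z)). Qed.

Lemma vanishesN n F : vanishes n F -> vanishes n (fun q => - F q).
Proof.
by move=> [r r0 [K K0 H]]; exists r => //; exists K => // q /H; rewrite nrmN.
Qed.

Lemma vanishesW n F : vanishes n.+1 F -> vanishes n F.
Proof.
move=> [r r0 [K K0 H]]; exists r => //; exists (K * r) => [|q qr].
  by rewrite mulr_ge0 // ltW.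
apply: le_trans (H q qr) _; rewrite exprS mulrA ler_wpM2r //.
  by rewrite exprn_ge0 // max_nrm_ge0.
by rewrite ler_wpM2l.
Qed.

Lemma vanishes_fst (g : C -> C) n (rho K : R) : 0 < rho -> 0 <= K ->
  (forall z, nrm z <= rho -> nrm (g z) <= K * nrm z ^+ n) ->
  vanishes n (fun q => g q.1).
Proof.
move=> r0 K0 H; exists rho => //; exists K => // q qr.
have q1 : nrm q.1 <= max_nrm q by rewrite le_max lexx.
apply: le_trans (H _ (le_trans q1 qr)) _.
by rewrite ler_wpM2l // lerXn2r // nnegrE ?nrm_ge0 ?max_nrm_ge0.
Qed.

Lemma vanishes_snd (g : C -> C) n (rho K : R) : 0 < rho -> 0 <= K ->
  (forall z, nrm z <= rho -> nrm (g z) <= K * nrm z ^+ n) ->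
  vanishes n (fun q => g q.2).
Proof.
move=> r0 K0 H; exists rho => //; exists K => // q qr.
have q1 : nrm q.2 <= max_nrm q by rewrite le_max lexx orbT.
apply: le_trans (H _ (le_trans q1 qr)) _.
by rewrite ler_wpM2l // lerXn2r // nnegrE ?nrm_ge0 ?max_nrm_ge0.
Qed.

Lemma vanishes_bigO F : vanishes 4 F ->
  F =O_ (nbhs ((0, 0) : C * C)) (fun q => `|q| ^+ 4 : C).
Proof.
move=> [r r0 [K K0 H]]; apply/eqO_exP; exists (ofR (K + 1)).
  by rewrite ltcR ltr_wpDl.
have r0' : 0 < ofR r by rewrite ltcR.
near=> q.
have : `|((0, 0) : C * C) - q| <= ofR r.
  near: q; apply: filterS (nbhsx_ballx ((0, 0) : C * C) _ r0') => q.
  by rewrite -ball_normE /= => /ltW.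
rewrite sub0r normrN norm_max_nrm le_ofR => /H Hq.
rewrite -[ofR _ ^+ 4]rmorphXn !norm_nrm nrm_ofR -ofRM le_ofR.
rewrite ger0_norm ?exprn_ge0 ?max_nrm_ge0 //.
apply: le_trans Hq _; rewrite ler_wpM2r ?exprn_ge0 ?max_nrm_ge0 //.
by rewrite lerDl.
Unshelve. all: by end_near. Qed.

Lemma nrm_iCM (z : C) : nrm (iC * z) = nrm z.
Proof.
by rewrite nrmM [X in X * _](_ : _ = 1) ?mul1r // /nrm /= expr0n add0r expr1n sqrtr1.
Qed.

(** With [l = expC (iC * kappa)] and [d = l - 1], the constant 3 in [p] assembles [- d ^+ 3], the
    even term gives [A / 2 * mu ^+ 2 * (d + d ^+ 2)] and the odd term
    [B / 6 * mu ^+ 3 * (2 + 3 * d + d ^+ 2)]. Replacing [d] by [iC * kappa] costs order two. *)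
Lemma characteristic_expansion (p : C -> C) (A B : C) (rho K : R) :
  0 < rho -> 0 <= K ->
  (forall z, nrm z <= rho -> nrm (p z - 3 - cubic 0 A B z) <= K * nrm z ^+ 4) ->
  vanishes 4 (fun q => - expC (iC * q.2) ^+ 3 + p q.1 * expC (iC * q.2) ^+ 2
    - p (- q.1) * expC (iC * q.2) + 1
    - (- (iC * q.2) ^+ 3 + iC * q.2 * q.1 ^+ 2 / 2 * A + q.1 ^+ 3 / 3 * B)).
Proof.
move=> r0 K0 H.
pose s q : C := iC * q.2; pose l q := expC (s q).
pose d q := l q - 1; pose e q := d q - s q.
have E2 : 0 <= 2 * expR 1 :> R by rewrite mulr_ge0 ?expR_ge0.
have E4 : 0 <= 4 * expR 1 :> R by rewrite mulr_ge0 ?expR_ge0.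
have vs : vanishes 1 s.
  apply: (@vanishes_snd (fun z => iC * z) 1 1 1) => // z _.
  by rewrite nrm_iCM mul1r.
have vd : vanishes 1 d.
  apply: (vanishes_snd (g := fun z => expC (iC * z) - 1) ltr01 E2) => z z1.
  by rewrite expr1 -(nrm_iCM z); apply: expC_sub1_le; rewrite nrm_iCM.
have ve : vanishes 2 e.
  apply: (vanishes_snd (g := fun z => expC (iC * z) - 1 - iC * z) ltr01 E4).
  by move=> z z1; rewrite -(nrm_iCM z); apply: expC_sub_le; rewrite nrm_iCM.
have vm : vanishes 1 (fun q => q.1).
  by apply: (@vanishes_fst id 1 1 1) => // z _; rewrite mul1r.
pose r z := p z - 3 - cubic 0 A B z.
have vr : vanishes 4 (fun q => r q.1) by apply: vanishes_fst H.
have vrN : vanishes 4 (fun q => r (- q.1)).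
  apply: (@vanishes_fst (fun z => r (- z)) 4 rho K) => // z zr.
  by rewrite -(nrmN z); apply: H; rewrite nrmN.
have vl : vanishes 0 l.
  rewrite (_ : l = fun q => d q + 1); last by apply/funext => q; rewrite subrK.
  by apply: vanishesD (vanishes_cst 1); exact: vanishesW.
have vd2 := vanishesM vd vd.
(* The five pieces of the error: [s ^+ 3 - d ^+ 3] factored through [e = d - s], the excess of the
   [A] and [B] terms, and the two Taylor remainders of [p]. *)
have t1 := vanishesN (vanishesM ve
  (vanishesD (vanishesD vd2 (vanishesM vd vs)) (vanishesM vs vs))).
have t2 := vanishesZ (A / 2) (vanishesM (vanishesM vm vm) (vanishesD ve vd2)).
have t3 := vanishesZ (B / 6) (vanishesM (vanishesM vm (vanishesM vm vm))
  (vanishesM vd (vanishesD (vanishes_cst 3) (vanishesW vd)))).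
have t4 := vanishesM vr (vanishesM vl vl).
have t5 := vanishesN (vanishesM vrN vl).
have := vanishesD (vanishesD (vanishesD t1 t2) (vanishesD t3 t4)) t5.
congr (vanishes 4 _); apply/funext => q.
by rewrite /r /e /d /cubic -/(l q) -/(s q); field.
Qed.

End OrderOfVanishing.

(** * Application to the traveling wave profile *)

Section Profile.
Context {R : realType}.
Local Notation C := (Cplx R).

Lemma tame_cderiv (T : R) (g g' : R -> C -> C) : 0 <= T -> tame T g g' ->
  cderiv (g T) (g' T).
Proof.
move=> T0 tg z; have [r r0 [K K0 H]] := tame2 z tg tg.
exists r => //; exists K => // w wr.
have TT : 0 <= T <= T by rewrite T0 lexx.
by have [|_ [] ] := H T z w TT _ wr; first by rewrite subrr nrm0 ltW.
Qed.

Lemma cderivD (g g' h h' : C -> C) : cderiv g g' -> cderiv h h' ->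
  cderiv (fun z => g z + h z) (fun z => g' z + h' z).
Proof.
move=> Hg Hh z; have [r r0 [K K0 H]] := Hg z; have [s s0 [L L0 I]] := Hh z.
exists (Num.min r s); first by rewrite lt_min r0.
exists (K + L) => [|w]; first by rewrite addr_ge0.
rewrite le_min => /andP[wr ws].
have -> : g w + h w - (g z + h z) - (w - z) * (g' z + h' z) =
  (g w - g z - (w - z) * g' z) + (h w - h z - (w - z) * h' z) by ring.
by rewrite [leRHS]mulrDl; apply: le_trans (nrmD _ _) _; rewrite lerD ?H ?I.
Qed.

Lemma cderiv_tr (M M' : C -> 'M[C]_3) :
  (forall i j, cderiv (fun z => M z i j) (fun z => M' z i j)) ->
  cderiv (fun z => \tr (M z)) (fun z => \tr (M' z)).
Proof.
have trE (N : C -> 'M[C]_3) : (fun z => \tr (N z)) =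
    (fun z => N z i0 i0 + N z i1 i1 + N z i2 i2).
  by apply/funext => z; rewrite /mxtrace sum3.
move=> H; rewrite !trE.
by do 2![apply: cderivD => //].
Qed.

Lemma period_ge0 (F : R -> R) um up p : 0 <= period F um up p.
Proof.
rewrite /period mulr_ge0 //; apply: Rintegral_ge0 => v _.
by rewrite invr_ge0 sqrtr_ge0.
Qed.

Context (f F : R -> R) (a E c : R) (um T : R) (u : R -> R).
Hypothesis hf : C2 f.
Hypothesis hu : is_profile f F (a, E, c) um T u.

Local Notation v := (derive1 u).
Local Notation w := (derive1n 2 u).
Let q x := - derive1 f (u x) + c.
Let dq x := - (v x * derive1n 2 f (u x)).

Lemma Hmx_companion (x : R) mu : Hmx f c u x mu = Hq q dq x mu.
Proof. by rewrite /Hq /companion /mx3 /dq ofRN. Qed.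

Lemma is_derive_derive1 (g : R -> R) (x : R) : derivable g x 1 ->
  is_derive x 1 g (derive1 g x).
Proof. by rewrite derive1E => /derivableP. Qed.

Lemma profile_derive (x : R) : is_derive x 1 u (v x).
Proof. exact/is_derive_derive1/(profile_derivable hu). Qed.

Lemma profile_derive2 (x : R) : is_derive x 1 v (w x).
Proof. exact/is_derive_derive1/(profile_derivable2 hu). Qed.

Lemma profile_derive1_f (x : R) : is_derive x 1 q (dq x).
Proof.
have [_ df' _] := hf.
have D := is_derive1_comp (is_derive_derive1 (df' (u x))) (profile_derive x).
apply: eq_is_derive (is_deriveD (is_deriveN D) (is_derive_cst c x 1)).
by rewrite addr0 mulrC.
Qed.

Lemma profile_wE (x : R) : w x = a - f (u x) + c * u x.
Proof. by have := profile_ode hu x; rewrite /pa /pc /=; lra. Qed.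

(** Differentiating the profile equation once gives [u''' = q u'], that is, [u'] lies in the kernel
    of the linearized operator. *)
Lemma profile_derive3 (x : R) : is_derive x 1 w (q x * v x).
Proof.
have -> : w = (cst a - f \o u) + c \*: u.
  by apply/funext => y; rewrite profile_wE.
have [df _ _] := hf.
have D := is_derive1_comp (is_derive_derive1 (df (u x))) (profile_derive x).
apply: eq_is_derive (is_deriveD (is_deriveB (is_derive_cst a x 1) D)
  (is_deriveZ c (profile_derive x))).
by rewrite /GRing.scale /= /q; ring.
Qed.

Lemma profile_uT : u T = u 0.
Proof. by rewrite -(profile_periodic hu 0) add0r. Qed.

Lemma profile_vT : v T = v 0.
Proof.
have D := @is_derive1_comp R u (id + cst T) 0 _ _ (profile_derive (0 + T))
  (is_deriveD (is_derive_id (0 : R) 1) (is_derive_cst T (0 : R) 1)).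
have uTE : u \o (id + cst T) = u.
  by apply/funext => x; rewrite -[RHS](profile_periodic hu).
rewrite uTE addr0 mulr1 add0r in D.
by have := profile_derive 0 => -[_ <-]; case: D.
Qed.

Context (Phi : R -> C -> 'M[C]_3).
Hypothesis hPhi : fundamental_solution f c u Phi.

Lemma fundamental_Phi0 mu : Phi 0 mu = 1%:M.
Proof. by have [] := hPhi mu. Qed.

Lemma fundamental_dPhi mu (x : R) :
  is_derive_mx x (Phi^~ mu) (Hq q dq x mu *m Phi x mu).
Proof. by move=> i j; rewrite -Hmx_companion; have [_] := hPhi mu. Qed.

Hypothesis T0 : 0 <= T.
Hypothesis w0 : w 0 != 0.

Let Phi0 := fundamental_Phi0.
Let dPhi := fundamental_dPhi.
Let qT : q T = q 0. Proof. by rewrite /q profile_uT. Qed.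
Let wT : w T = w 0. Proof. by rewrite !profile_wE profile_uT. Qed.
Let v0 : v 0 = 0. Proof. exact: profile_init' hu. Qed.

(** The similarity argument covers [mu != 0]; at 0 both traces are 3 by the shear form of the
    monodromy matrix. *)
Lemma tr_Psi_monodromy mu : \tr (Psi Phi T mu) = \tr (Phi T (- mu)).
Proof.
have [->|mu0] := eqVneq mu 0; last first.
  exact: (tr_Psi_period Phi0 dPhi profile_derive1_f qT mu0).
rewrite oppr0.
rewrite (tr_Psi_monodromy0 Phi0 dPhi profile_derive profile_derive2
  profile_derive3 profile_derive1_f profile_uT profile_vT wT qT v0 w0).
by rewrite (tr_monodromy0 Phi0 dPhi profile_derive profile_derive2
  profile_derive3 profile_derive1_f profile_uT profile_vT wT qT v0 w0).
Qed.

(** The first derivative is kept as the explicit [volterra], so that its trace at 0 can be computed;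
    the higher ones are iterates of a chosen derivation of the algebra. *)
Lemma monodromy_smooth : exists M : nat -> C -> 'M[C]_3,
  [/\ M 0%N = Phi T, M 1%N = fun mu => \matrix_(i, j) volterra Phi mu mu i j T &
  forall n i j, cderiv (fun mu => M n mu i j) (fun mu => M n.+1 mu i j)].
Proof.
(* Making the statement conditional on membership lets [choice] act on all functions; outside the
   algebra [g] itself is a dummy value. *)
have next g : exists g', flow_alg Phi g -> flow_alg Phi g' /\ tame T g g'.
  have [ag|nag] := pselect (flow_alg Phi g); last first.
    by exists g => ag; exfalso; exact: nag ag.
  have [g' ag' tg] := flow_alg_tame Phi0 dPhi T0 ag.
  by exists g' => _; split; [exact: ag'|exact: tg].
have [s sP] := choice next.
pose V i j x mu := volterra Phi mu mu i j x.
have aV n i j : flow_alg Phi (iter n s (V i j)).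
  elim: n => [|n IH] /=; first exact: flow_alg_volterra.
  by have [] := sP _ IH.
pose N n mu : 'M[C]_3 := \matrix_(i, j) iter n s (V i j) T mu.
have NE n i j : (fun mu => N n mu i j) = iter n s (V i j) T.
  by apply/funext => mu; rewrite mxE.
exists (fun n => if n is m.+1 then N m else Phi T).
split; [exact: erefl|exact: erefl|move=> [|n] i j]; rewrite !NE.
- exact: (tame_cderiv T0 (tame_Phi Phi0 dPhi T0 i j)).
- exact: (tame_cderiv T0 (sP _ (aV n i j)).2).
Qed.

Lemma monodromy_expansion :
  (fun z : C * C =>
     \det (Phi T z.1 - (expC (iC * z.2))%:M) -
     (- (iC * z.2) ^+ 3
      + iC * z.2 * z.1 ^+ 2 / 2 * \tr (derive1n 2 (Phi T) 0)
      + z.1 ^+ 3 / 3 * \tr (derive1n 3 (Phi T) 0)))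
  =O_ (nbhs ((0, 0) : C * C)) (fun z : C * C => `|z| ^+ 4 : C).
Proof.
have [M [M0 M1 dM]] := monodromy_smooth.
have MS n : derive1 (M n) = M n.+1 by exact: derive1_cderiv_mx (dM n).
have -> : derive1n 2 (Phi T) = M 2%N by rewrite -M0 /derive1n /= !MS.
have -> : derive1n 3 (Phi T) = M 3%N by rewrite -M0 /derive1n /= !MS.
have dtr n := cderiv_tr (dM n).
have [r r0 [K K0 H]] := taylor3 (dtr 0%N) (dtr 1%N) (dtr 2%N) (dtr 3%N).
have tr1 : \tr (M 1%N 0) = 0.
  rewrite M1 /mxtrace; under eq_bigr do rewrite mxE.
  exact: (tr_volterra0 Phi0 dPhi profile_derive profile_derive2 profile_derive3
    profile_derive1_f profile_uT profile_vT wT qT v0 w0).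
have tr0 : \tr (Phi T 0) = 3.
  exact: (tr_monodromy0 Phi0 dPhi profile_derive profile_derive2
    profile_derive3 profile_derive1_f profile_uT profile_vT wT qT v0 w0).
rewrite M0 tr1 tr0 in H.
apply: vanishes_bigO; have := characteristic_expansion r0 K0 H.
congr (vanishes 4 _); apply/funext => z.
by rewrite (det_Phi_sub Phi0 dPhi) tr_Psi_monodromy.
Qed.

End Profile.

Theorem lemma2 (R : realType) (f F : R -> R) (a E c : R)
    (um up : R * R * R -> R) (u : R -> R)
    (Phi : R -> Cplx R -> 'M[Cplx R]_3)
    (hf : C2 f)
    (hF : forall v : R, is_derive v 1 F (f v))
    (hroots : root_branch F (a, E, c) um up)
    (hu : is_profile f F (a, E, c) (um (a, E, c)) (period F um up (a, E, c)) u)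
    (hT : derive1 (fun s : R => period F um up (s, E, c)) a <> 0 \/
          derive1 (fun s : R => period F um up (a, s, c)) E <> 0)
    (hPhi : fundamental_solution f c u Phi) :
  let M (mu : Cplx R) := Phi (period F um up (a, E, c)) mu in
  let D (mu lambda : Cplx R) := \det (M mu - lambda%:M) in
  (fun q : Cplx R * Cplx R =>
     let mu := q.1 in let kappa := q.2 in
     D mu (expC (iC * kappa)) -
     (- (iC * kappa) ^+ 3
      + iC * kappa * mu ^+ 2 / 2 * \tr (derive1n 2 M 0)
      + mu ^+ 3 / 3 * \tr (derive1n 3 M 0)))
  =O_ (nbhs ((0, 0) : Cplx R * Cplx R))
  (fun q : Cplx R * Cplx R => `|q| ^+ 4 : Cplx R).
Proof.
move=> M D.
have T0 := period_ge0 F um up (a, E, c).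
have u0 := profile_init hu.
have [[_ _ [_ Vum] _ _] _ _] := nbhs_singleton hroots.
(* The profile equation at 0 reads [u''(0) = - V'(u_-)], which is nonzero because [u_-] is a simple
   root. *)
have w0 : derive1n 2 u 0 != 0.
  rewrite (profile_wE hu); apply/eqP => w0; apply: Vum.
  have dV : is_derive (um (a, E, c)) 1 (potential F (a, E, c))
      (f (um (a, E, c)) - c * um (a, E, c) - a).
    set x := um (a, E, c).
    have -> : potential F (a, E, c) =
        F - (c / 2) \*: (id * id : R -> R) - a \*: (id : R -> R).
      by apply/funext => y; rewrite /potential expr2.
    have Dx := is_derive_id x 1.
    apply: eq_is_derive (is_deriveB (is_deriveB (hF x)
      (is_deriveZ (c / 2) (is_deriveM Dx Dx))) (is_deriveZ a Dx)).
    have half_double : c / 2 * (x * 1 + x * 1) = c * x by field.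
    by congr (_ - _ - _); [exact: half_double|exact: mulr1].
  rewrite derive1E (derive_val (is_derive := dV)) -u0.
  apply: (@oppr_inj R); rewrite oppr0 -[RHS]w0; ring.
exact: (monodromy_expansion hf hu hPhi T0 w0).
Qed.
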